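(* Let $\mathcal A$ and $\mathcal B$ be $C^*$-algebras with Pedersen ideals $\mathcal P_{\mathcal A}$ and $\mathcal P_{\mathcal B}$. If $\mathcal P_{\mathcal A}$ and $\mathcal P_{\mathcal B}$ are Morita $^*$-equivalent, then they are formally Morita equivalent.
   Context: The Pedersen ideal $\mathcal P_{\mathcal A}$ of a $C^*$-algebra $\mathcal A$ is its minimal dense (two-sided) ideal; it is regarded as a $^*$-algebra over $\mathbb C$. Pedersen ideals are non-degenerate ($aR=0$ or $Ra=0$ implies $a=0$) and idempotent (products span). A complex pre-Hilbert space $\mathfrak H$ is a complex vector space with positive-definite Hermitian product, linear in the second argument; $\mathfrak B(\mathfrak H)$ is the $^*$-algebra of all linear maps $\mathfrak H\to\mathfrak H$ having an adjoint on $\mathfrak H$. A $^*$-representation of a complex $^*$-algebra $R$ is a $^*$-homomorphism $\pi:R\to\mathfrak B(\mathfrak H)$. A linear functional $\omega:R\to\mathbb C$ is positive if $\omega(a^*a)\ge0$ for all $a$; $R^+$ is the set of Hermitian $a\in R$ with $\omega(a)\ge0$ for all positive $\omega$. Modules carry compatible $\mathbb C$-vector space structures. Inner products. For a right $R$-module $\mathfrak X$, an $R$-valued inner product is a map $\langle\cdot,\cdot\rangle_R:\mathfrak X\times\mathfrak X\to R$ that is $\mathbb C$-linear and right $R$-linear in the second argument with $\langle x,y\rangle_R=\langle y,x\rangle_R^*$. It is positive semi-definite if $\langle x,x\rangle_R\in R^+$ for all $x$, and full if the linear span of all $\langle x,y\rangle_R$ is $R$. For a left $S$-module, ${}_S\langle\cdot,\cdot\rangle$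 is defined analogously with linearity in the first argument. Morita $^*$-equivalence. Non-degenerate idempotent $^*$-algebras $R$, $S$ are Morita $^*$-equivalent if there is a right $R$-module $\mathcal E$ with $\mathcal E\cdot R=\mathcal E$ (i.e. spanned by the $x\cdot r$), such that $x\cdot R=0$ implies $x=0$, with a full $R$-valued inner product $\langle\cdot,\cdot\rangle$ (no positivity required) such that $\langle x,\mathcal E\rangle=0$ implies $x=0$, and with $S\cong\mathfrak F(\mathcal E_R)$ as $^*$-algebras, where $\mathfrak F(\mathcal E_R)$ is the linear span of the operators $\Theta_{x,y}:z\mapsto x\cdot\langle y,z\rangle$, with $\Theta_{x,y}^*=\Theta_{y,x}$. Formal Morita equivalence. $R$ and $S$ are formally Morita equivalent if there is an $(S$-$R)$-equivalence bimodule, i.e. an $(S$-$R)$-bimodule $\mathfrak X$ with full positive semi-definite inner products $\langle\cdot,\cdot\rangle_R$ and ${}_S\langle\cdot,\cdot\rangle$ such that: $\langle s\cdot x,y\rangle_R=\langle x,s^*\cdot y\rangle_R$ and ${}_S\langle x\cdot r,y\rangle={}_S\langle x,y\cdot r^*\rangle$; $x\cdot\langle y,z\rangle_R={}_S\langle x,y\rangle\cdot z$; property P: for every $^*$-representation $(\pi,\mathfrak H)$ of $R$ on a pre-Hilbert space the Hermitian product on $\mathfrak X\otimes_R\mathfrak H$ determined by $\langle x\otimes\psi,y\otimes\phi\rangle=\langle\psi,\pi(\langle x,y\rangle_R)\phi\rangle_{\mathfrak H}$ is positive semi-definite; property Q: the conjugate $(R$-$S)$-bimodule $\overline{\mathfrak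 X}$ (same additive group, elements $\overline x$, with $z\overline x=\overline{\overline zx}$, $r\cdot\overline x=\overline{x\cdot r^*}$, $\overline x\cdot s=\overline{s^*\cdot x}$, $\langle\overline x,\overline y\rangle_S={}_S\langle x,y\rangle$) has property P with respect to $S$. *)

(* Defs.v *)
(* MathComp and MathComp-Analysis.  The complex numbers are R[i] with
   R : realType; the purely algebraic notions are stated over any
   numClosedFieldType C, where 0 <= z means that z is real and nonnegative. *)
From HB Require Import structures.
From mathcomp Require Import all_boot all_order all_algebra.
From mathcomp Require Import generic_quotient complex.
From mathcomp Require Import all_classical all_reals all_analysis.

Set Implicit Arguments.
Unset Strict Implicit.
Unset Printing Implicit Defensive.

Import Order.TTheory GRing.Theory Num.Theory.
Import numFieldNormedType.Exports.

Local Open Scope classical_set_scope.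
Local Open Scope quotient_scope.
Local Open Scope ring_scope.

Reserved Notation "a ⋅ b" (at level 40, left associativity).
Reserved Notation "x ◃ r" (at level 40, left associativity).
Reserved Notation "s ▹ x" (at level 40, left associativity).

(* Algebras need not be unital, so MathComp's rings do not apply. *)
HB.mixin Record Lmodule_isStarAlgebra (C : numClosedFieldType) A
    of GRing.Lmodule C A := {
  amul : A -> A -> A;
  star : A -> A;
  amulA : associative amul;
  amulDl : left_distributive amul +%R;
  amulDr : right_distributive amul +%R;
  amulZl : forall (z : C) a b, amul (z *: a) b = z *: amul a b;
  amulZr : forall (z : C) a b, amul a (z *: b) = z *: amul a b;
  starK : involutive star;
  starD : {morph star : a b / a + b};
  starZ : forall (z : C) a, star (z *: a) = z^* *: star a;
  starM : forall a b, star (amul a b) = amul (star b) (star a)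
}.

#[short(type="starAlgType")]
HB.structure Definition StarAlgebra (C : numClosedFieldType) :=
  {A of GRing.Lmodule C A & Lmodule_isStarAlgebra C A}.

Notation "a ⋅ b" := (amul a b) : ring_scope.

HB.mixin Record Lmodule_isRightModule (C : numClosedFieldType)
    (R : starAlgType C) X of GRing.Lmodule C X := {
  ract : X -> R -> X;
  ractDl : forall x y r, ract (x + y) r = ract x r + ract y r;
  ractDr : forall x r s, ract x (r + s) = ract x r + ract x s;
  ractZl : forall (z : C) x r, ract (z *: x) r = z *: ract x r;
  ractZr : forall (z : C) x r, ract x (z *: r) = z *: ract x r;
  ractA : forall x r s, ract (ract x r) s = ract x (r ⋅ s)
}.

#[short(type="rightModType")]
HB.structure Definition RightModule (C : numClosedFieldType)
  (R : starAlgType C) :=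
  {X of GRing.Lmodule C X & Lmodule_isRightModule C R X}.

Notation "x ◃ r" := (ract x r) : ring_scope.

HB.mixin Record Lmodule_isLeftModule (C : numClosedFieldType)
    (S : starAlgType C) X of GRing.Lmodule C X := {
  lact : S -> X -> X;
  lactDl : forall s t x, lact (s + t) x = lact s x + lact t x;
  lactDr : forall s x y, lact s (x + y) = lact s x + lact s y;
  lactZl : forall (z : C) s x, lact (z *: s) x = z *: lact s x;
  lactZr : forall (z : C) s x, lact s (z *: x) = z *: lact s x;
  lactA : forall s t x, lact s (lact t x) = lact (s ⋅ t) x
}.

#[short(type="leftModType")]
HB.structure Definition LeftModule (C : numClosedFieldType)
  (S : starAlgType C) :=
  {X of GRing.Lmodule C X & Lmodule_isLeftModule C S X}.

Notation "s ▹ x" := (lact s x) : ring_scope.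

HB.mixin Record isBimodule (C : numClosedFieldType) (S R : starAlgType C) X
    of RightModule C R X & LeftModule C S X := {
  lractA : forall (s : S) (x : X) (r : R), (s ▹ x) ◃ r = s ▹ (x ◃ r)
}.

#[short(type="bimodType")]
HB.structure Definition Bimodule (C : numClosedFieldType)
  (S R : starAlgType C) :=
  {X of RightModule C R X & LeftModule C S X & isBimodule C S R X}.

Definition lspan (C : numClosedFieldType) (V : lmodType C) (A : set V)
    : set V :=
  [set v | exists2 s : seq (C * V),
      (forall p, p \in s -> A p.2) & v = \sum_(p <- s) p.1 *: p.2].

Section Positivity.
Variables (C : numClosedFieldType) (R : starAlgType C).

Definition positive_functional (w : {scalar R}) : Prop :=
  forall a : R, 0 <= w (star a ⋅ a).

Definition positive_elements : set R :=
  [set a | star a = a /\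
     forall w : {scalar R}, positive_functional w -> 0 <= w a].

End Positivity.

Section InnerProducts.
Variables (C : numClosedFieldType).

Record right_inner_product (R : starAlgType C) (X : rightModType R)
    (ip : X -> X -> R) : Prop := {
  ripD : forall x y z, ip x (y + z) = ip x y + ip x z;
  ripZ : forall (c : C) x y, ip x (c *: y) = c *: ip x y;
  ripA : forall x y r, ip x (y ◃ r) = ip x y ⋅ r;
  ripC : forall x y, ip x y = star (ip y x)
}.

Record left_inner_product (S : starAlgType C) (X : leftModType S)
    (ip : X -> X -> S) : Prop := {
  lipD : forall x y z, ip (x + y) z = ip x z + ip y z;
  lipZ : forall (c : C) x y, ip (c *: x) y = c *: ip x y;
  lipA : forall s x y, ip (s ▹ x) y = s ⋅ ip x y;
  lipC : forall x y, ip x y = star (ip y x)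
}.

Definition ip_positive (R : starAlgType C) (X : Type) (ip : X -> X -> R)
    : Prop := forall x, positive_elements (ip x x).

Definition ip_full (R : starAlgType C) (X : Type) (ip : X -> X -> R) : Prop :=
  lspan [set r | exists x y, r = ip x y] = [set: R].

End InnerProducts.

HB.mixin Record Lmodule_isPreHilbert (C : numClosedFieldType) H
    of GRing.Lmodule C H := {
  hdot : H -> H -> C;
  hdotD : forall x y z, hdot x (y + z) = hdot x y + hdot x z;
  hdotZ : forall (c : C) x y, hdot x (c *: y) = c * hdot x y;
  hdotC : forall x y, hdot x y = (hdot y x)^*;
  hdot_gt0 : forall x, x != 0 -> 0 < hdot x x
}.

#[short(type="preHilbertType")]
HB.structure Definition PreHilbert (C : numClosedFieldType) :=
  {H of GRing.Lmodule C H & Lmodule_isPreHilbert C H}.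

(* A * -homomorphism from R into the * -algebra B(H) of the adjointable linear
   maps: pi (star a) is the (unique) adjoint of pi a. *)
Record star_representation (C : numClosedFieldType) (R : starAlgType C)
    (H : preHilbertType C) (pi : R -> H -> H) : Prop := {
  srep_linear : forall a, linear (pi a);
  srepD : forall a b psi, pi (a + b) psi = pi a psi + pi b psi;
  srepZ : forall (c : C) a psi, pi (c *: a) psi = c *: pi a psi;
  srepM : forall a b psi, pi (a ⋅ b) psi = pi a (pi b psi);
  srep_adjoint : forall a phi psi,
    hdot (pi a phi) psi = hdot phi (pi (star a) psi)
}.

Section TensorProduct.
Variables (C : numClosedFieldType) (R : starAlgType C) (X : rightModType R).
Variables (H : lmodType C) (pi : R -> H -> H).

(* The tensor product of X and (H, pi) over R is the free commutative monoid
   on X * H (formal finite sums, written as lists) modulo the relations below;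
   the quotient is automatically a C-vector space. *)
Inductive tensor_rel : seq (X * H) -> seq (X * H) -> Prop :=
| TensRefl s : tensor_rel s s
| TensSym s t of tensor_rel s t : tensor_rel t s
| TensTrans s t u of tensor_rel s t & tensor_rel t u : tensor_rel s u
| TensCat s s' t t' of tensor_rel s s' & tensor_rel t t' :
    tensor_rel (s ++ t) (s' ++ t')
| TensC s t : tensor_rel (s ++ t) (t ++ s)
| Tens0 psi : tensor_rel [:: (0, psi)] [::]
| TensDl x y psi : tensor_rel [:: (x + y, psi)] [:: (x, psi); (y, psi)]
| TensDr x phi psi : tensor_rel [:: (x, phi + psi)] [:: (x, phi); (x, psi)]
| TensZ (c : C) x psi : tensor_rel [:: (c *: x, psi)] [:: (x, c *: psi)]
| TensR x r psi : tensor_rel [:: (x ◃ r, psi)] [:: (x, pi r psi)].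

Definition tensor_relb : rel (seq (X * H)) := fun s t => `[< tensor_rel s t >].

Lemma tensor_relb_equiv : equiv_class_of tensor_relb.
Proof.
split=> [s|s t|t s u].
- by apply/asboolP; exact: TensRefl.
- by apply/idP/idP => /asboolP h; apply/asboolP; exact: TensSym.
- move=> /asboolP h1 /asboolP h2; apply/asboolP; exact: TensTrans h1 h2.
Qed.

Canonical tensor_equiv := EquivRelPack tensor_relb_equiv.

Definition tensor := {eq_quot tensor_equiv}.

HB.instance Definition _ := Choice.on tensor.
HB.instance Definition _ := EqQuotient.on tensor.

Lemma tensorP s t : reflect (tensor_rel s t) (s == t %[mod tensor]).
Proof. by rewrite eqmodE; exact: asboolP. Qed.

Lemma tensor_repr s : tensor_rel (repr (\pi_tensor s)) s.
Proof. by apply/tensorP; rewrite reprK. Qed.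

Lemma tensorW (K : tensor -> Prop) : (forall s, K (\pi_tensor s)) -> forall u, K u.
Proof. by move=> h u; rewrite -[u]reprK. Qed.

Definition tensor0 : tensor := \pi_tensor [::].
Definition tensor_add (u v : tensor) : tensor := \pi_tensor (repr u ++ repr v).
Definition tscale (c : C) (s : seq (X * H)) := [seq (c *: p.1, p.2) | p <- s].
Definition tensor_scale (c : C) (u : tensor) : tensor :=
  \pi_tensor (tscale c (repr u)).
Definition tensor_opp (u : tensor) : tensor := tensor_scale (-1) u.

Lemma tscale_rel c s t : tensor_rel s t -> tensor_rel (tscale c s) (tscale c t).
Proof.
elim=> {s t} /=.
- by move=> s; exact: TensRefl.
- by move=> s t _; exact: TensSym.
- by move=> s t u _ h1 _; exact: TensTrans.
- by move=> s s' t t' _ h1 _ h2; rewrite /tscale !map_cat; exact: TensCat.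
- by move=> s t; rewrite /tscale !map_cat; exact: TensC.
- by move=> psi; rewrite scaler0; exact: Tens0.
- by move=> x y psi; rewrite scalerDr; exact: TensDl.
- by move=> x phi psi; exact: TensDr.
- by move=> d x psi; rewrite scalerA mulrC -scalerA; exact: TensZ.
- by move=> x r psi; rewrite -ractZl; exact: TensR.
Qed.

Lemma tensor_pi_add s t :
  tensor_add (\pi_tensor s) (\pi_tensor t) = \pi_tensor (s ++ t).
Proof. by apply/eqP/tensorP; apply: TensCat; exact: tensor_repr. Qed.

Lemma tensor_pi_scale c s :
  tensor_scale c (\pi_tensor s) = \pi_tensor (tscale c s).
Proof. by apply/eqP/tensorP; apply: tscale_rel; exact: tensor_repr. Qed.

Lemma tensor_addA : associative tensor_add.
Proof.
move=> u v w; elim/tensorW: u => s; elim/tensorW: v => t; elim/tensorW: w => r.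
by rewrite !tensor_pi_add catA.
Qed.

Lemma tensor_addC : commutative tensor_add.
Proof.
move=> u v; elim/tensorW: u => s; elim/tensorW: v => t; rewrite !tensor_pi_add.
by apply/eqP/tensorP; exact: TensC.
Qed.

Lemma tensor_add0 : left_id tensor0 tensor_add.
Proof. by move=> u; elim/tensorW: u => s; rewrite tensor_pi_add. Qed.

Lemma tscaleDl_rel a b s :
  tensor_rel (tscale (a + b) s) (tscale a s ++ tscale b s).
Proof.
elim: s => [|[x psi] s ih]; first exact: TensRefl.
have e c : tscale c ((x, psi) :: s) = [:: (c *: x, psi)] ++ tscale c s by [].
rewrite !e scalerDl; apply: TensTrans (TensCat (TensDl _ _ _) ih) _.
rewrite -[[:: _; _]]/([:: (a *: x, psi)] ++ [:: (b *: x, psi)]) -!catA.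
apply: TensCat; first exact: TensRefl.
by rewrite !catA; apply: TensCat; [exact: TensC|exact: TensRefl].
Qed.

Lemma tscale0_rel s : tensor_rel (tscale 0 s) [::].
Proof.
elim: s => [|[x psi] s ih]; first exact: TensRefl.
rewrite -[[::]]/([::] ++ [::] : seq (X * H)) /= scale0r.
by apply: (TensCat (s := [:: (0, psi)]) (s' := [::])) ih; exact: Tens0.
Qed.

Lemma tscale1 s : tscale 1 s = s.
Proof.
by rewrite /tscale -[RHS]map_id; apply: eq_map => -[x psi]; rewrite scale1r.
Qed.

Lemma tensor_addN : left_inverse tensor0 tensor_opp tensor_add.
Proof.
move=> u; elim/tensorW: u => s; rewrite /tensor_opp tensor_pi_scale tensor_pi_add.
apply/eqP/tensorP; rewrite -{2}[s]tscale1.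
apply: TensTrans (TensSym (tscaleDl_rel _ _ _)) _.
by rewrite addNr; exact: tscale0_rel.
Qed.

HB.instance Definition _ :=
  GRing.isZmodule.Build tensor tensor_addA tensor_addC tensor_add0 tensor_addN.

Lemma tensor_scaleA a b u :
  tensor_scale a (tensor_scale b u) = tensor_scale (a * b) u.
Proof.
elim/tensorW: u => s; rewrite !tensor_pi_scale /tscale -map_comp.
by congr (\pi _); apply: eq_map => p /=; rewrite scalerA.
Qed.

Lemma tensor_scale1 : left_id 1 tensor_scale.
Proof. by move=> u; elim/tensorW: u => s; rewrite tensor_pi_scale tscale1. Qed.

Lemma tensor_scaleDr : right_distributive tensor_scale +%R.
Proof.
move=> a u v; elim/tensorW: u => s; elim/tensorW: v => t.
by rewrite [_ + _]tensor_pi_add !tensor_pi_scale [RHS]tensor_pi_add /tscale map_cat.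
Qed.

Lemma tensor_scaleDl u : {morph tensor_scale^~ u : a b / a + b}.
Proof.
move=> a b; elim/tensorW: u => s; rewrite !tensor_pi_scale [RHS]tensor_pi_add.
by apply/eqP/tensorP; exact: tscaleDl_rel.
Qed.

HB.instance Definition _ := GRing.Zmodule_isLmodule.Build C tensor
  tensor_scaleA tensor_scale1 tensor_scaleDr tensor_scaleDl.

Definition tens (x : X) (psi : H) : tensor := \pi_tensor [:: (x, psi)].

End TensorProduct.

Section TensorForm.
Variables (C : numClosedFieldType) (R : starAlgType C) (X : rightModType R).
Variables (ip : X -> X -> R) (H : preHilbertType C) (pi : R -> H -> H).

Definition formal_form (s t : seq (X * H)) : C :=
  \sum_(p <- s) \sum_(q <- t) hdot p.2 (pi (ip p.1 q.1) q.2).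

(* The choice of the representatives is irrelevant, see tensor_form_tens and
   tensor_formE. *)
Definition tensor_form (u v : tensor X pi) : C :=
  formal_form (repr u) (repr v).

Hypotheses (ipP : right_inner_product ip) (piP : star_representation pi).

Lemma formal_formC s t : formal_form s t = (formal_form t s)^*.
Proof.
rewrite /formal_form rmorph_sum exchange_big /=; apply: eq_bigr => q _.
rewrite rmorph_sum; apply: eq_bigr => p _.
by rewrite (ripC ipP) -(srep_adjoint piP) hdotC.
Qed.

Lemma formal_form_rel s t t' :
  tensor_rel pi t t' -> formal_form s t = formal_form s t'.
Proof.
have hdot0 (x : H) : hdot x 0 = 0 by rewrite -(scale0r 0) hdotZ mul0r.
move=> h; rewrite /formal_form; apply: eq_bigr => -[x psi] _ /=.
elim: h => {t t'} //=.
- by move=> r t u _ -> _ ->.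
- by move=> r r' t t' _ h1 _ h2; rewrite !big_cat /= h1 h2.
- by move=> r t; rewrite !big_cat /= addrC.
- move=> phi; rewrite big_seq1 big_nil /= -(scale0r (0 : X)) (ripZ ipP).
  by rewrite (srepZ piP) scale0r hdot0.
- move=> y z phi; rewrite !big_cons big_nil /= !addr0 (ripD ipP) (srepD piP).
  by rewrite hdotD.
- move=> y phi phi'; rewrite !big_cons big_nil /= !addr0 -hdotD; congr (hdot _ _).
  by have := srep_linear piP (ip x y) 1 phi phi'; rewrite !scale1r.
- move=> c y phi; rewrite !big_seq1 /= (ripZ ipP) (srepZ piP).
  have := srep_linear piP (ip x y) c phi 0; rewrite !addr0 => ->.
  have := srep_linear piP (ip x y) (-1) 0 0.
  by rewrite scaler0 addr0 scaleN1r addNr => ->; rewrite addr0.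
- by move=> y r phi; rewrite !big_seq1 /= (ripA ipP) (srepM piP).
Qed.

Lemma tensor_formE s t :
  tensor_form (\pi_(tensor X pi) s) (\pi_(tensor X pi) t) = formal_form s t.
Proof.
rewrite /tensor_form (formal_form_rel _ (tensor_repr pi t)).
by rewrite formal_formC (formal_form_rel _ (tensor_repr pi s)) -formal_formC.
Qed.

Lemma tensor_form_tens x psi y phi :
  tensor_form (tens pi x psi) (tens pi y phi) = hdot psi (pi (ip x y) phi).
Proof. by rewrite tensor_formE /formal_form !big_seq1. Qed.

End TensorForm.

Definition property_P (C : numClosedFieldType) (R : starAlgType C)
    (X : rightModType R) (ip : X -> X -> R) : Prop :=
  forall (H : preHilbertType C) (pi : R -> H -> H), star_representation pi ->
  forall u : tensor X pi, 0 <= tensor_form ip u u.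

Section Conjugate.
Variable C : numClosedFieldType.

Definition conjmod (V : Type) : Type := V.
Definition to_conj (V : Type) : V -> conjmod V := id.
Definition of_conj (V : Type) : conjmod V -> V := id.

HB.instance Definition _ (V : zmodType) := GRing.Zmodule.on (conjmod V).

Section ConjLmodule.
Variable V : lmodType C.

Definition conj_scale (z : C) (x : conjmod V) : conjmod V :=
  to_conj (z^* *: of_conj x).

Lemma conj_scaleA a b x : conj_scale a (conj_scale b x) = conj_scale (a * b) x.
Proof. by rewrite /conj_scale /of_conj /to_conj scalerA rmorphM. Qed.
Lemma conj_scale1 : left_id 1 conj_scale.
Proof. by move=> x; rewrite /conj_scale rmorph1 [LHS]scale1r. Qed.
Lemma conj_scaleDr : right_distributive conj_scale +%R.
Proof. by move=> a x y; exact: scalerDr. Qed.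
Lemma conj_scaleDl x : {morph conj_scale^~ x : a b / a + b}.
Proof. by move=> a b; rewrite /conj_scale rmorphD [LHS]scalerDl. Qed.

HB.instance Definition _ := GRing.Zmodule_isLmodule.Build C (conjmod V)
  conj_scaleA conj_scale1 conj_scaleDr conj_scaleDl.
End ConjLmodule.

Section ConjBimodule.
Variables (S R : starAlgType C) (X : bimodType S R).
Implicit Types (x y : conjmod X) (s t : S) (r q : R).

Definition conj_lact r x : conjmod X := to_conj (of_conj x ◃ star r).
Definition conj_ract x s : conjmod X := to_conj (star s ▹ of_conj x).

Lemma conj_ractDl x y s : conj_ract (x + y) s = conj_ract x s + conj_ract y s.
Proof. exact: lactDr. Qed.
Lemma conj_ractDr x s t : conj_ract x (s + t) = conj_ract x s + conj_ract x t.
Proof. by rewrite /conj_ract starD; exact: lactDl. Qed.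
Lemma conj_ractZl (z : C) x s : conj_ract (z *: x) s = z *: conj_ract x s.
Proof. exact: lactZr. Qed.
Lemma conj_ractZr (z : C) x s : conj_ract x (z *: s) = z *: conj_ract x s.
Proof. by rewrite /conj_ract starZ; exact: lactZl. Qed.
Lemma conj_ractA x s t : conj_ract (conj_ract x s) t = conj_ract x (s ⋅ t).
Proof. by rewrite /conj_ract starM; exact: lactA. Qed.

HB.instance Definition _ := Lmodule_isRightModule.Build C S (conjmod X)
  conj_ractDl conj_ractDr conj_ractZl conj_ractZr conj_ractA.

Lemma conj_lactDl r q x : conj_lact (r + q) x = conj_lact r x + conj_lact q x.
Proof. by rewrite /conj_lact starD ractDr. Qed.
Lemma conj_lactDr r x y : conj_lact r (x + y) = conj_lact r x + conj_lact r y.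
Proof. exact: (ractDl (of_conj x)). Qed.
Lemma conj_lactZl (z : C) r x : conj_lact (z *: r) x = z *: conj_lact r x.
Proof. by rewrite /conj_lact starZ ractZr. Qed.
Lemma conj_lactZr (z : C) r x : conj_lact r (z *: x) = z *: conj_lact r x.
Proof. exact: (ractZl _ (of_conj x)). Qed.
Lemma conj_lactA r q x : conj_lact r (conj_lact q x) = conj_lact (r ⋅ q) x.
Proof. by rewrite /conj_lact starM -ractA. Qed.

HB.instance Definition _ := Lmodule_isLeftModule.Build C R (conjmod X)
  conj_lactDl conj_lactDr conj_lactZl conj_lactZr conj_lactA.

Lemma conj_lractA r x s : (r ▹ x) ◃ s = r ▹ (x ◃ s).
Proof. by rewrite /ract /lact /= /conj_ract /conj_lact /= lractA. Qed.

HB.instance Definition _ := isBimodule.Build C R S (conjmod X) conj_lractA.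

Definition conj_ip (ip : X -> X -> S) (x y : conjmod X) : S :=
  ip (of_conj x) (of_conj y).

End ConjBimodule.
End Conjugate.

Record equivalence_bimodule (C : numClosedFieldType) (S R : starAlgType C)
    (X : bimodType S R) (ipR : X -> X -> R) (ipS : X -> X -> S) : Prop := {
  eqb_ipR : right_inner_product ipR;
  eqb_ipR_pos : ip_positive ipR;
  eqb_ipR_full : ip_full ipR;
  eqb_ipS : left_inner_product ipS;
  eqb_ipS_pos : ip_positive ipS;
  eqb_ipS_full : ip_full ipS;
  eqb_adjR : forall (s : S) x y, ipR (s ▹ x) y = ipR x (star s ▹ y);
  eqb_adjS : forall (r : R) x y, ipS (x ◃ r) y = ipS x (y ◃ star r);
  eqb_compat : forall x y z, x ◃ ipR y z = ipS x y ▹ z;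
  eqb_P : property_P ipR;
  eqb_Q : property_P (conj_ip ipS)
}.

Definition formally_Morita_equivalent (C : numClosedFieldType)
    (R S : starAlgType C) : Prop :=
  exists (X : bimodType S R) (ipR : X -> X -> R) (ipS : X -> X -> S),
    equivalence_bimodule ipR ipS.

Section MoritaStar.
Variables (C : numClosedFieldType) (R S : starAlgType C).

Definition nondegenerate_alg (A : starAlgType C) : Prop :=
  (forall a : A, (forall b, a ⋅ b = 0) -> a = 0) /\
  (forall a : A, (forall b, b ⋅ a = 0) -> a = 0).

Definition idempotent_alg (A : starAlgType C) : Prop :=
  lspan [set c : A | exists a b, c = a ⋅ b] = [set: A].

Section FiniteRank.
Variables (E : rightModType R) (ip : E -> E -> R).

Definition Theta (x y : E) : E -> E := fun z => x ◃ ip y z.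

Definition finite_rank : set (E -> E) :=
  lspan [set f | exists x y, f = Theta x y].

(* phi : S -> F(E) is an isomorphism of * -algebras; the involution of F(E) is
   the conjugate linear extension of Theta x y |-> Theta y x (well defined as
   soon as ip is nondegenerate). *)
Record star_iso_finite_rank (phi : S -> E -> E) : Prop := {
  sif_inj : injective phi;
  sif_onto : range phi = finite_rank;
  sifD : forall a b, phi (a + b) = phi a + phi b;
  sifZ : forall (c : C) a, phi (c *: a) = c *: phi a;
  sifM : forall a b, phi (a ⋅ b) = phi a \o phi b;
  sif_star : forall a (s : seq (C * (E * E))),
    phi a = \sum_(p <- s) p.1 *: Theta p.2.1 p.2.2 ->
    phi (star a) = \sum_(p <- s) (p.1)^* *: Theta p.2.2 p.2.1
}.

Record Morita_star_module : Prop := {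
  msm_idem : lspan [set y : E | exists x (r : R), y = x ◃ r] = [set: E];
  msm_nondeg : forall x : E, (forall r : R, x ◃ r = 0) -> x = 0;
  msm_ip : right_inner_product ip;
  msm_full : ip_full ip;
  msm_ip_nondeg : forall x : E, (forall y, ip x y = 0) -> x = 0;
  msm_iso : exists phi : S -> E -> E, star_iso_finite_rank phi
}.

End FiniteRank.

Definition Morita_star_equivalent : Prop :=
  [/\ nondegenerate_alg R /\ idempotent_alg R,
      nondegenerate_alg S /\ idempotent_alg S &
      exists (E : rightModType R) (ip : E -> E -> R), Morita_star_module ip].

End MoritaStar.

HB.mixin Record StarAlgebra_isCStar (R : realType) A
    of StarAlgebra R[i] A & CompleteNormedModule R[i] A := {
  amul_norm_le : forall a b : A, `|a ⋅ b| <= `|a| * `|b|;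
  cstar_norm : forall a : A, `|star a ⋅ a| = `|a| ^+ 2
}.

#[short(type="cstarAlgType")]
HB.structure Definition CStarAlgebra (R : realType) :=
  {A of StarAlgebra R[i] A & CompleteNormedModule R[i] A
      & StarAlgebra_isCStar R A}.

Section Pedersen.
Variables (R : realType) (A : cstarAlgType R).

Record two_sided_ideal (I : set A) : Prop := {
  ideal0 : I 0;
  idealD : forall a b, I a -> I b -> I (a + b);
  idealZ : forall (z : R[i]) a, I a -> I (z *: a);
  idealMl : forall a b, I b -> I (a ⋅ b);
  idealMr : forall a b, I a -> I (a ⋅ b)
}.

Definition Pedersen_ideal (P : set A) : Prop :=
  [/\ two_sided_ideal P, dense P &
      forall I : set A, two_sided_ideal I -> dense I -> P `<=` I].

Lemma star0 : star 0 = 0 :> A.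
Proof. by rewrite -(scale0r 0) starZ conjC0 !scale0r. Qed.

Lemma norm_star (a : A) : `|star a| = `|a|.
Proof.
have le (b : A) : `|b| <= `|star b| :> R[i].
  have [->|b0] := eqVneq b 0; first by rewrite star0.
  have := amul_norm_le (star b) b; rewrite cstar_norm expr2.
  by rewrite ler_pM2r // normr_gt0.
by apply/le_anti; rewrite le -{2}[a]starK le.
Qed.

Lemma starB (a b : A) : star (a - b) = star a - star b.
Proof. by rewrite starD -scaleN1r starZ rmorphN rmorph1 scaleN1r. Qed.

Lemma star_continuous : continuous (star : A -> A).
Proof.
move=> a; apply/cvgrPdist_lt => e e0; near=> b.
by rewrite -starB norm_star; near: b; apply: cvgr_dist_lt.
Unshelve. all: by end_near. Qed.

Lemma Pedersen_star (P : set A) : Pedersen_ideal P ->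
  forall a, P a -> P (star a).
Proof.
move=> [idP dP minP]; apply: (minP [set a | P (star a)]).
  split=> /=.
  - by rewrite star0; exact: ideal0 idP.
  - by move=> a b Pa Pb; rewrite starD; exact: (idealD idP).
  - by move=> z a Pa; rewrite starZ; exact: (idealZ idP).
  - by move=> a b Pb; rewrite starM; exact: (idealMr idP).
  - by move=> a b Pa; rewrite starM; exact: (idealMl idP).
move=> O [x Ox] oO.
have [||y [/= Oy Py]] := dP (star @^-1` O).
- by exists (star x); rewrite /preimage /= starK.
- by apply: open_comp => // z _; exact: star_continuous.
by exists (star y); split => //=; rewrite starK.
Qed.

Section PedersenAlgebra.
Variables (P : set A) (hP : Pedersen_ideal P).

Definition Pedersen_pred of Pedersen_ideal P : {pred A} := [pred a | a \in P].

Lemma Pedersen_subsemimod : subsemimod_closed (Pedersen_pred hP).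
Proof.
have [idP _ _] := hP; split; first split.
- by rewrite inE; exact: ideal0 idP.
- by move=> a b; rewrite !inE; exact: (idealD idP).
- by move=> z a; rewrite !inE; exact: (idealZ idP).
Qed.

HB.instance Definition _ :=
  GRing.isSubmodClosed.Build R[i] A (Pedersen_pred hP) Pedersen_subsemimod.

(* The Pedersen ideal P, as a * -algebra over the complex numbers. *)
Record Pedersen_alg := PedersenAlg {
  Pedersen_val :> A;
  Pedersen_valP : Pedersen_val \in Pedersen_pred hP }.

HB.instance Definition _ := [isSub for Pedersen_val].
HB.instance Definition _ := [Choice of Pedersen_alg by <:].
HB.instance Definition _ := [SubChoice_isSubLmodule of Pedersen_alg by <:].

Lemma Pedersen_mul_subproof (a b : Pedersen_alg) :
  Pedersen_val a ⋅ Pedersen_val b \in Pedersen_pred hP.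
Proof.
by have [idP _ _] := hP; case: b => b /=; rewrite !inE; exact: (idealMl idP).
Qed.

Lemma Pedersen_star_subproof (a : Pedersen_alg) :
  star (Pedersen_val a) \in Pedersen_pred hP.
Proof. by case: a => a /=; rewrite !inE; exact: Pedersen_star. Qed.

Definition Pedersen_mul (a b : Pedersen_alg) : Pedersen_alg :=
  PedersenAlg (Pedersen_mul_subproof a b).
Definition Pedersen_adj (a : Pedersen_alg) : Pedersen_alg :=
  PedersenAlg (Pedersen_star_subproof a).

Lemma Pedersen_mulA : associative Pedersen_mul.
Proof. by move=> a b c; apply/val_inj; exact: amulA. Qed.
Lemma Pedersen_mulDl : left_distributive Pedersen_mul +%R.
Proof. by move=> a b c; apply/val_inj; exact: amulDl. Qed.
Lemma Pedersen_mulDr : right_distributive Pedersen_mul +%R.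
Proof. by move=> a b c; apply/val_inj; exact: amulDr. Qed.
Lemma Pedersen_mulZl (z : R[i]) a b :
  Pedersen_mul (z *: a) b = z *: Pedersen_mul a b.
Proof. by apply/val_inj; exact: amulZl. Qed.
Lemma Pedersen_mulZr (z : R[i]) a b :
  Pedersen_mul a (z *: b) = z *: Pedersen_mul a b.
Proof. by apply/val_inj; exact: amulZr. Qed.
Lemma Pedersen_adjK : involutive Pedersen_adj.
Proof. by move=> a; apply/val_inj; exact: starK. Qed.
Lemma Pedersen_adjD : {morph Pedersen_adj : a b / a + b}.
Proof. by move=> a b; apply/val_inj; exact: starD. Qed.
Lemma Pedersen_adjZ (z : R[i]) a :
  Pedersen_adj (z *: a) = z^* *: Pedersen_adj a.
Proof. by apply/val_inj; exact: starZ. Qed.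
Lemma Pedersen_adjM a b :
  Pedersen_adj (Pedersen_mul a b) = Pedersen_mul (Pedersen_adj b) (Pedersen_adj a).
Proof. by apply/val_inj; exact: starM. Qed.

HB.instance Definition _ := Lmodule_isStarAlgebra.Build R[i] Pedersen_alg
  Pedersen_mulA Pedersen_mulDl Pedersen_mulDr Pedersen_mulZl Pedersen_mulZr
  Pedersen_adjK Pedersen_adjD Pedersen_adjZ Pedersen_adjM.

End PedersenAlgebra.
End Pedersen.

(* Main.v *)
(* Let E be a Morita module for R and S, ideals in C*-algebras A and B, and write
   Theta_{x,y} for the S-valued inner product of E.  The R-valued one need not
   be positive, but z = 0 as soon as <z,z> = 0, because then the self-adjoint
   Theta_{z,z} has square 0.  Split each p = Theta_{y,y} as p_+ - p_- in B.  As
   <x, p x> = <y,x>* <y,x> >= 0, vectors in the range of sqrt|p| p_+ have positive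
   and those in the range of sqrt|p| p_- negative inner squares; a nonzero
   p_+ c p'_- would produce an isotropic vector, so p_+ B p'_- = 0 for all y, y'.
   Hence E is the orthogonal sum of a positive and a negative submodule, and
   changing the sign of the inner products on the latter makes both of them
   positive.

   It remains to see that a positive inner product is completely positive, i.e.
   that sum_ij <psi_i, pi(<x_i,x_j>) psi_j> >= 0.  The form b |-> sum_ij <psi_i,
   pi(<x_i, b x_j>) psi_j> is nonnegative on b = u* Theta_{y,y} u, where it is a
   sum of squares, and it is norm continuous in b because its diagonal
   coefficients are positive functionals.  Moreover 1 is approximated, relative
   to the x_i, by sums of elements u* Theta_{x_k,x_k} u.

   Square roots come from a convergent iteration in the unitization, and the
   positivity of x* x from Kaplansky's argument, without spectral theory. *)
Require Import Defs.
From HB Require Import structures.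
From mathcomp Require Import all_boot all_order all_algebra.
From mathcomp Require Import complex ring lra.
From mathcomp Require Import all_classical all_reals all_analysis.

Set Implicit Arguments.
Unset Strict Implicit.
Unset Printing Implicit Defensive.

Import Order.TTheory GRing.Theory Num.Theory.
Import numFieldNormedType.Exports.

Local Open Scope classical_set_scope.
Local Open Scope ring_scope.

(** * Elementary identities in *-algebras *)

Section StarAlgebraTheory.
Variables (C : numClosedFieldType) (A : starAlgType C).
Implicit Types a b c : A.

Lemma amul0l a : 0 ⋅ a = 0. Proof. by rewrite -(scale0r 0) amulZl !scale0r. Qed.
Lemma amul0r a : a ⋅ 0 = 0. Proof. by rewrite -(scale0r 0) amulZr !scale0r. Qed.
Lemma star_0 : star 0 = 0 :> A.
Proof. by rewrite -(scale0r 0) starZ conjC0 !scale0r. Qed.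
Lemma star_N a : star (- a) = - star a.
Proof. by rewrite -scaleN1r starZ rmorphN rmorph1 scaleN1r. Qed.

Lemma amul_suml I (r : seq I) (F : I -> A) b :
  (\sum_(i <- r) F i) ⋅ b = \sum_(i <- r) F i ⋅ b.
Proof.
by elim/big_rec2: _ => [|i y x _ <-]; rewrite ?amul0l // amulDl.
Qed.
Lemma star_sum I (r : seq I) (F : I -> A) :
  star (\sum_(i <- r) F i) = \sum_(i <- r) star (F i).
Proof.
by elim/big_rec2: _ => [|i y x _ <-]; rewrite ?star_0 // starD.
Qed.

End StarAlgebraTheory.

(** * The unitization of a C*-algebra *)

Definition unitization (T : realType) (A : cstarAlgType T) : Type :=
  (T[i] * A)%type.

Section Unitization.
Variables (T : realType) (A : cstarAlgType T).
Local Notation C := T[i].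
Local Notation U := (unitization A).

HB.instance Definition _ := GRing.Zmodule.copy U (C * A)%type.

Definition unitz_scale (z : C) (u : U) : U := (z * u.1, z *: u.2).

Definition unitz_mul (u v : U) : U :=
  (u.1 * v.1, u.1 *: v.2 + v.1 *: u.2 + u.2 ⋅ v.2).
Definition unitz_one : U := (1, 0).

Lemma unitz_eq (u v : U) : u.1 = v.1 -> u.2 = v.2 -> u = v.
Proof. by case: u v => [? ?] [? ?] /= -> ->. Qed.

Lemma unitz_scaleA x y u : unitz_scale x (unitz_scale y u) = unitz_scale (x * y) u.
Proof. by apply: unitz_eq; rewrite /= ?mulrA ?scalerA. Qed.
Lemma unitz_scale1 : left_id 1 unitz_scale.
Proof. by move=> u; apply: unitz_eq; rewrite /= ?mul1r ?scale1r. Qed.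
Lemma unitz_scaleDr : right_distributive unitz_scale +%R.
Proof. by move=> x u v; apply: unitz_eq; rewrite /= ?mulrDr ?scalerDr. Qed.
Lemma unitz_scaleDl u : {morph unitz_scale^~ u : x y / x + y}.
Proof. by move=> x y; apply: unitz_eq; rewrite /= ?mulrDl ?scalerDl. Qed.

HB.instance Definition _ := GRing.Zmodule_isLmodule.Build C U
  unitz_scaleA unitz_scale1 unitz_scaleDr unitz_scaleDl.

Lemma unitz_mulA : associative unitz_mul.
Proof.
move=> [x a] [y b] [z c]; apply: unitz_eq => /=; first by rewrite mulrA.
rewrite !amulDr !amulDl !scalerDr !amulZl !amulZr !scalerA !amulA.
rewrite [z * x]mulrC [z * y]mulrC -!addrA; congr (_ + _); congr (_ + _).
rewrite addrCA; congr (_ + _).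
by rewrite [RHS]addrCA; congr (_ + _); rewrite [RHS]addrCA.
Qed.
Lemma unitz_mul1l : left_id unitz_one unitz_mul.
Proof.
by move=> [x a]; apply: unitz_eq; rewrite /= ?mul1r // scale1r scaler0 amul0l !addr0.
Qed.
Lemma unitz_mul1r : right_id unitz_one unitz_mul.
Proof.
by move=> [x a]; apply: unitz_eq; rewrite /= ?mulr1 // scale1r scaler0 amul0r addr0 add0r.
Qed.
Lemma unitz_mulDl : left_distributive unitz_mul +%R.
Proof.
move=> [x a] [y b] [z c]; apply: unitz_eq => /=; first by rewrite mulrDl.
by rewrite amulDl scalerDl scalerDr [RHS]addrACA; congr (_ + _); rewrite addrACA.
Qed.
Lemma unitz_mulDr : right_distributive unitz_mul +%R.
Proof.
move=> [x a] [y b] [z c]; apply: unitz_eq => /=; first by rewrite mulrDr.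
by rewrite amulDr scalerDl scalerDr [RHS]addrACA; congr (_ + _); rewrite addrACA.
Qed.
Lemma unitz_1neq0 : unitz_one != 0.
Proof. by apply/eqP => -[/eqP]; rewrite oner_eq0. Qed.

HB.instance Definition _ := GRing.Zmodule_isNzRing.Build U
  unitz_mulA unitz_mul1l unitz_mul1r unitz_mulDl unitz_mulDr unitz_1neq0.

Lemma unitz_scaleAl (z : C) (u v : U) : z *: (u * v) = (z *: u) * v.
Proof.
apply: unitz_eq => /=; first by rewrite [LHS]mulrA.
by rewrite !scalerDr amulZl !scalerA [v.1 * z]mulrC.
Qed.
HB.instance Definition _ := GRing.Lmodule_isLalgebra.Build C U unitz_scaleAl.

Lemma unitz_scaleAr (z : C) (u v : U) : z *: (u * v) = u * (z *: v).
Proof.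
apply: unitz_eq => /=; first by rewrite [LHS]mulrCA.
by rewrite !scalerDr amulZr !scalerA [u.1 * z]mulrC.
Qed.
HB.instance Definition _ := GRing.Lalgebra_isAlgebra.Build C U unitz_scaleAr.

Definition ustar (u : U) : U := (u.1^*, star u.2).

Lemma ustarK : involutive ustar.
Proof. by move=> [x a]; rewrite /ustar /= conjCK starK. Qed.
Lemma ustarD u v : ustar (u + v) = ustar u + ustar v.
Proof. by apply: unitz_eq; rewrite /= ?rmorphD ?starD. Qed.
Lemma ustarZ (z : C) u : ustar (z *: u) = z^* *: ustar u.
Proof. by apply: unitz_eq; rewrite /= ?rmorphM ?starZ. Qed.
Lemma ustarM u v : ustar (u * v) = ustar v * ustar u.
Proof.
apply: unitz_eq => /=; first by rewrite rmorphM mulrC.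
by rewrite !starD starM !starZ [X in X + _]addrC.
Qed.
Lemma ustar1 : ustar 1 = 1.
Proof. by apply: unitz_eq; rewrite /= ?rmorph1 // star_0. Qed.
Lemma ustarN u : ustar (- u) = - ustar u.
Proof. by rewrite -scaleN1r ustarZ rmorphN rmorph1 scaleN1r. Qed.
Lemma ustar0 : ustar 0 = 0.
Proof. by apply: unitz_eq; rewrite /= ?conjC0 ?star_0. Qed.
Lemma ustarB u v : ustar (u - v) = ustar u - ustar v.
Proof. by rewrite ustarD ustarN. Qed.
Lemma ustarX u n : ustar (u ^+ n) = ustar u ^+ n.
Proof. by elim: n => [|n ih]; rewrite ?expr0 ?ustar1 // exprS ustarM ih exprSr. Qed.

Definition incl (a : A) : U := (0, a).

Lemma inclM a b : incl (a ⋅ b) = incl a * incl b.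
Proof. by apply: unitz_eq; rewrite /= ?mul0r // !scale0r !add0r. Qed.
Lemma inclD a b : incl (a + b) = incl a + incl b.
Proof. by apply: unitz_eq; rewrite /= ?addr0. Qed.
Lemma inclZ (z : C) a : incl (z *: a) = z *: incl a.
Proof. by apply: unitz_eq; rewrite /= ?mulr0. Qed.
Lemma incl_star a : incl (star a) = ustar (incl a).
Proof. by apply: unitz_eq; rewrite /= ?conjC0. Qed.
Lemma incl_inj : injective incl.
Proof. by move=> a b []. Qed.

Definition mact (u : U) (b : A) : A := u.1 *: b + u.2 ⋅ b.

Lemma mactM u v b : mact (u * v) b = mact u (mact v b).
Proof.
rewrite /mact /= !amulDl !amulDr !scalerDr !amulZl !amulZr !scalerA amulA.
by rewrite -!addrA; congr (_ + _); congr (_ + _).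
Qed.
Lemma mactD u v b : mact (u + v) b = mact u b + mact v b.
Proof. by rewrite /mact /= scalerDl amulDl addrACA. Qed.
Lemma mactZ (z : C) u b : mact (z *: u) b = z *: mact u b.
Proof. by rewrite /mact /= amulZl scalerDr scalerA. Qed.
Lemma mact_ustar u b c : star (mact u b) ⋅ c = star b ⋅ mact (ustar u) c.
Proof.
by rewrite /mact starD starZ starM amulDl amulDr amulZl amulZr amulA.
Qed.
Lemma incl_mact u b : incl (mact u b) = u * incl b.
Proof. by apply: unitz_eq; rewrite /= ?mulr0 // scale0r addr0. Qed.

Lemma ccD (x y : T) : (x + y)%:C%C = x%:C%C + y%:C%C :> C.
Proof. by rewrite rmorphD. Qed.
Lemma ccM (x y : T) : (x * y)%:C%C = x%:C%C * y%:C%C :> C.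
Proof. by rewrite rmorphM. Qed.

(* The larger of |u.1| and the norm of left multiplication by u on A is a
   C*-norm on the unitization, also when A is already unital; norm_le u M says
   that it is at most M. *)
Definition norm_le (u : U) (M : T) : Prop :=
  `|u.1| <= M%:C%C /\ forall b : A, `|mact u b| <= M%:C%C * `|b|.

Lemma norm_le_ge0 u M : norm_le u M -> 0 <= M.
Proof. by case=> h _; have := le_trans (normr_ge0 _) h; rewrite lecR. Qed.

Lemma norm_leW u M N : M <= N -> norm_le u M -> norm_le u N.
Proof.
move=> MN [h1 h2]; split=> [|b]; first by rewrite (le_trans h1) ?lecR.
by rewrite (le_trans (h2 b)) // ler_wpM2r ?lecR.
Qed.

Lemma norm_leD u v M N : norm_le u M -> norm_le v N -> norm_le (u + v) (M + N).
Proof.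
move=> [h1 h2] [k1 k2]; split=> [|b].
  by rewrite ccD (le_trans (ler_normD _ _)) ?lerD.
by rewrite mactD ccD mulrDl (le_trans (ler_normD _ _)) ?lerD.
Qed.

Lemma norm_leZ (x : T) u M : 0 <= x -> norm_le u M -> norm_le (x%:C%C *: u) (x * M).
Proof.
move=> x0 [h1 h2]; have nx : `|x%:C%C| = x%:C%C by rewrite ger0_norm ?ler0c.
split=> [|b]; first by rewrite normrM nx ccM ler_wpM2l ?ler0c.
by rewrite mactZ normrZ nx ccM -mulrA ler_wpM2l ?ler0c.
Qed.

Lemma norm_leZ1 (z : C) u M : `|z| = 1 -> norm_le u M -> norm_le (z *: u) M.
Proof.
move=> z1 [h1 h2]; split=> [|b]; first by rewrite normrM z1 mul1r.
by rewrite mactZ normrZ z1 mul1r.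
Qed.

Lemma norm_leN u M : norm_le u M -> norm_le (- u) M.
Proof. by rewrite -scaleN1r; apply: norm_leZ1; rewrite normrN1. Qed.

Lemma norm_leB u v M N : norm_le u M -> norm_le v N -> norm_le (u - v) (M + N).
Proof. by move=> h k; apply: norm_leD => //; exact: norm_leN. Qed.

Lemma norm_leM u v M N : norm_le u M -> norm_le v N -> norm_le (u * v) (M * N).
Proof.
move=> h k; have M0 := norm_le_ge0 h; case: h k => [h1 h2] [k1 k2].
split=> [|b]; first by rewrite normrM ccM ler_pM.
rewrite mactM ccM (le_trans (h2 _)) // -mulrA ler_wpM2l ?ler0c //.
Qed.

Lemma norm_le1 : norm_le 1 1.
Proof. by split=> [|b]; rewrite /mact /= ?normr1 ?scale1r ?amul0l ?addr0 ?mul1r. Qed.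

Lemma norm_le0 M : 0 <= M -> norm_le 0 M.
Proof.
move=> M0; split=> [|b]; rewrite /mact /= ?scale0r ?amul0l ?addr0 normr0 ?ler0c //.
by rewrite mulr_ge0 ?ler0c.
Qed.

Lemma normE (V : normedModType C) (b : V) : exists2 r : T, 0 <= r & `|b| = r%:C%C.
Proof.
have := normr_ge0 b; case: `|b| => x y; rewrite lecE /= => /andP[/eqP-> x0].
by exists x.
Qed.

Lemma norm_le_ex u : exists M, norm_le u M.
Proof.
have [r r0 rE] : exists2 r : T, 0 <= r & `|u.1| = r%:C%C.
  have := normr_ge0 u.1; case: `|u.1| => x y; rewrite lecE /= => /andP[/eqP-> x0].
  by exists x.
  have [s s0 sE] := normE u.2.
exists (r + s); split=> [|b]; first by rewrite [X in X <= _]rE lecR lerDl.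
rewrite ccD mulrDl (le_trans (ler_normD _ _)) // lerD //.
  by rewrite normrZ [X in X * _]rE.
by rewrite -sE amul_norm_le.
Qed.

Lemma normCE (z : C) : exists2 r : T, 0 <= r & `|z| = r%:C%C.
Proof.
have := normr_ge0 z; case: `|z| => x y; rewrite lecE /= => /andP[/eqP-> x0].
by exists x.
Qed.

(** Taking b = a* in the hypothesis, the C*-identity gives |a|^2 <= M |a|. *)
Lemma norm_le_incl (a : A) (M : T) : 0 <= M ->
  (forall b, `|a ⋅ b| <= M%:C%C * `|b|) -> `|a| <= M%:C%C.
Proof.
move=> M0 h; have [->|a0] := eqVneq a 0; first by rewrite normr0 ler0c.
have := h (star a); have := cstar_norm (star a); rewrite starK norm_star => ->.
by rewrite expr2 ler_pM2r // normr_gt0.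
Qed.

(** Left multiplication by [u.2] is [mact u] minus the scalar [u.1], each bounded by M. With
    [norm_le_pair] this compares [norm_le] with the norms of the two coordinates, so that
    completeness passes to the unitization. *)
Lemma norm_le_snd u M : norm_le u M -> `|u.2| <= (M + M)%:C%C.
Proof.
move=> h; have M0 := norm_le_ge0 h; case: h => h1 h2.
apply: norm_le_incl => [|b]; first by rewrite addr_ge0.
have -> : u.2 ⋅ b = mact u b - u.1 *: b by rewrite /mact addrAC subrr add0r.
rewrite ccD mulrDl (le_trans (ler_normB _ _)) // lerD // normrZ.
by rewrite ler_wpM2r.
Qed.

Lemma norm_le_pair u (M N : T) :
  `|u.1| <= M%:C%C -> `|u.2| <= N%:C%C -> norm_le u (M + N).
Proof.
move=> h1 h2; split=> [|b].
  rewrite ccD (le_trans h1) // lerDl; exact: le_trans h2.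
rewrite ccD mulrDl (le_trans (ler_normD _ _)) // lerD //.
  by rewrite normrZ ler_wpM2r.
by rewrite (le_trans (amul_norm_le _ _)) // ler_wpM2r.
Qed.

Lemma norm_le_eps u M :
  (forall e, 0 < e -> norm_le u (M + e)) -> norm_le u M.
Proof.
move=> h; split=> [|b].
  have [r r0 rE] := normCE u.1; rewrite rE lecR; apply/ler_addgt0Pr => e e0.
  by have [] := h e e0; rewrite rE lecR.
have [r r0 rE] := normE (mact u b); have [s s0 sE] := normE b.
rewrite rE sE -ccM lecR; apply/ler_addgt0Pr => e e0.
have s1 : 0 < s + 1 by rewrite ltr_wpDl.
have [|_ /(_ b)] := h (e / (s + 1)); first by rewrite divr_gt0.
rewrite rE sE -ccM lecR => /le_trans; apply.
rewrite mulrDl lerD // -mulrA ler_piMr ?(ltW e0) // mulrC.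
by rewrite ler_pdivrMr // mul1r lerDl.
Qed.

Lemma norm_le_eq0 u : norm_le u 0 -> u = 0.
Proof.
move=> h; have := norm_le_snd h; case: h; rewrite addr0 => + _.
by rewrite !normr_le0 => /eqP h1 /eqP h2; apply: unitz_eq.
Qed.

(** By the C*-identity of A, |u b|^2 = |b* u* u b| <= M^2 |b|^2. *)
Lemma norm_le_cstar u M : 0 <= M -> norm_le (ustar u * u) (M ^+ 2) -> norm_le u M.
Proof.
move=> M0 [h1 h2]; split=> [|b].
  have [r r0 rE] := normCE u.1; rewrite rE lecR.
  have : `|u.1^* * u.1| <= (M ^+ 2)%:C%C := h1; rewrite normrM norm_conjC rE -ccM lecR -expr2.
  by rewrite ler_pXn2r.
have [r r0 rE] := normE (mact u b); have [s s0 sE] := normE b.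
rewrite rE sE -ccM lecR -(@ler_pXn2r _ 2) ?nnegrE ?mulr_ge0 // -lecR.
rewrite -[(r ^+ 2)%:C%C]/((r * r)%:C%C) ccM -rE -expr2 -cstar_norm.
rewrite mact_ustar -mactM (le_trans (amul_norm_le _ _)) // norm_star.
rewrite (le_trans (ler_wpM2l _ (h2 b))) // sE -!ccM lecR.
by rewrite exprMn mulrCA [s * _]mulrC.
Qed.

(** Here |u* b|^2 = |b* u u* b| <= |b| M |u* b|, and |u* b| cancels. *)
Lemma norm_le_ustar u M : norm_le u M -> norm_le (ustar u) M.
Proof.
move=> h; have M0 := norm_le_ge0 h; split=> [|b].
  by rewrite norm_conjC; case: h.
have [->|nz] := eqVneq (mact (ustar u) b) 0; first by rewrite normr0 mulr_ge0 ?ler0c.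
have := cstar_norm (mact (ustar u) b); rewrite mact_ustar ustarK => eq.
have : `|mact (ustar u) b| * `|mact (ustar u) b| <= M%:C%C * `|b| * `|mact (ustar u) b|.
  rewrite -expr2 -eq (le_trans (amul_norm_le _ _)) // norm_star.
  by rewrite -mulrA mulrCA ler_wpM2l //; case: h.
by rewrite ler_pM2r // normr_gt0.
Qed.

Definition converges (t : nat -> U) (l : U) : Prop :=
  forall e, 0 < e -> exists N, forall n, (N <= n)%N -> norm_le (t n - l) e.

Lemma cauchy_limit (K : numFieldType) (V : completeNormedModType K)
    (a : nat -> V) :
  (forall e, 0 < e -> exists N, forall n, (N <= n)%N -> `|a n - a N| < e) ->
  exists l, forall e, 0 < e -> exists N, forall n, (N <= n)%N -> `|a n - l| < e.
Proof.
move=> h; have /cauchyP/cauchy_cvg/cvg_ex[l /cvgrPdist_lt hl] : cauchy_ex (a @ \oo).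
  move=> e e0; have [N hN] := h e e0; exists (a N); exists N => // n /= Nn.
  by rewrite -ball_normE /= distrC hN.
exists l => e e0; have [N _ hN] := hl e e0; exists N => n Nn.
by rewrite distrC; exact: hN.
Qed.

Lemma norm_ci : `|'i%C : C| = 1.
Proof. by rewrite normc_def /= expr0n expr1n add0r sqrtr1. Qed.

Lemma norm_cc (x : T) : `|x%:C%C : C| = `|x|%:C%C.
Proof. by rewrite normc_def /= expr0n addr0 sqrtr_sqr. Qed.

Lemma normc_ge_Im (z : C) : `|complex.Im z|%:C%C <= `|z|.
Proof.
rewrite -normrN -ReiNIm (le_trans (normc_ge_Re _)) //.
by rewrite normrM norm_ci mulr1.
Qed.

(** The bounds telescope, so t is Cauchy because the monotone bounded scalar sequence s converges.
    The limit is assembled from those of the real part, the imaginary part and the component in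
    A. *)
Lemma converges_increments (t : nat -> U) (s : nat -> T) (B : T) :
  (forall n, norm_le (t n.+1 - t n) (s n.+1 - s n)) -> (forall n, s n <= B) ->
  exists l, converges t l.
Proof.
move=> ht sB.
have tt m n : norm_le (t (m + n)%N - t m) (s (m + n)%N - s m).
  elim: n => [|n ih]; first by rewrite addn0 !subrr; apply: norm_le0.
  by rewrite addnS; have := norm_leD (ht (m + n)%N) ih; rewrite !addrA !subrK.
have [c cs] : exists c, forall e : T, 0 < e -> exists N, forall n, (N <= n)%N -> `|s n - c| < e.
  exists (limn s) => e e0.
  have /cvgrPdist_lt/(_ e e0)[N _ hN] : cvgn s.
    apply: nondecreasing_is_cvgn.
      by move=> m n /subnKC <-; rewrite -subr_ge0; exact: norm_le_ge0 (tt _ _).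
    by exists B => _ [n _ <-]; exact: sB.
  by exists N => n Nn; rewrite distrC; exact: hN.
have cau (e : T) : 0 < e -> exists N, forall n, (N <= n)%N -> norm_le (t n - t N) e.
  move=> e0; have [N hN] := cs _ (divr_gt0 e0 (ltr0Sn T 1)).
  exists N => n Nn; apply: norm_leW (_ : s n - s N <= e) _.
    have := hN n Nn; have := hN N (leqnn _); rewrite !ltr_norml => /andP[] + _ /andP[_].
    lra.
  by have := tt N (n - N)%N; rewrite subnKC.
have cauR (f : C -> T) (fB : forall x y, f (x - y) = f x - f y)
    (fle : forall x, `|f x|%:C%C <= `|x|) :
  exists l, forall e : T, 0 < e -> exists N, forall n, (N <= n)%N -> `|f (t n).1 - l| < e.
  apply: (@cauchy_limit T T) => e e0; have [N hN] := cau _ (divr_gt0 e0 (ltr0Sn T 1)).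
  exists N => n Nn; rewrite -fB -ltcR (le_lt_trans (fle _)) //.
  by have [h _] := hN n Nn; rewrite (le_lt_trans h) // ltcR gtr_pMr // invf_lt1 // ltr1n.
have [x hx] := cauR (@complex.Re T) (fun _ _ => raddfB _ _ _) (@normc_ge_Re _).
have [y hy] := cauR (@complex.Im T) (fun _ _ => raddfB _ _ _) normc_ge_Im.
have [a ha] : exists l, forall e : C, 0 < e -> exists N, forall n, (N <= n)%N -> `|(t n).2 - l| < e.
  apply: cauchy_limit => e; rewrite ltcE /= => /andP[/eqP e1 e0].
  (* [norm_le_snd] doubles the bound, so a third of e leaves a strict inequality. *)
  have [N hN] := cau _ (divr_gt0 e0 (ltr0Sn T 2)).
  exists N => n Nn; have := norm_le_snd (hN n Nn); move=> /le_lt_trans; apply.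
  by rewrite ltcE /= e1 eqxx /=; lra.
have e4 (e : T) : 0 < e -> 0 < e / 4 by move=> e0; rewrite divr_gt0.
exists (x +i* y, a)%C => e /e4 e0.
have [N1 h1] := hx _ e0; have [N2 h2] := hy _ e0.
have [|N3 h3] := ha (e / 4)%:C%C; first by rewrite ltcR.
exists (N1 + N2 + N3)%N => n Nn; have [||| k1 k2 k3] := And3 (h1 n _) (h2 n _) (h3 n _).
- by apply: leq_trans Nn; rewrite -addnA leq_addr.
- by apply: leq_trans Nn; rewrite addnAC leq_addl.
- by apply: leq_trans Nn; rewrite leq_addl.
have -> : e = (e / 4 + e / 4) + (e / 4 + e / 4) by lra.
apply: norm_le_pair; last by rewrite (le_trans (ltW k3)) // lecR; lra.
set w := _.1; have -> : w = (complex.Re (t n).1 - x)%:C%C + 'i%C * (complex.Im (t n).1 - y)%:C%C.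
  by rewrite /w /=; case: (t n) => -[p q] b /=; simpc.
rewrite [(e / 4 + e / 4)%:C%C]ccD (le_trans (ler_normD _ _)) // lerD // ?normrM.
  by rewrite norm_cc lecR ltW.
by rewrite norm_ci mul1r norm_cc lecR ltW.
Qed.

Lemma norm_le_all_eq0 u : (forall e, 0 < e -> norm_le u e) -> u = 0.
Proof.
by move=> h; apply/norm_le_eq0/norm_le_eps => e e0; rewrite add0r; exact: h.
Qed.

Lemma converges_le t l M :
  (forall n, norm_le (t n) M) -> converges t l -> norm_le l M.
Proof.
move=> tM tl; apply: norm_le_eps => e e0; have [N hN] := tl e e0.
have -> : l = t N - (t N - l) by rewrite opprB addrC subrK.
exact: norm_leB (tM N) (hN N (leqnn N)).
Qed.

Lemma converges_unique t l l' : converges t l -> converges t l' -> l = l'.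
Proof.
move=> h h'; apply/eqP; rewrite -subr_eq0; apply/eqP/norm_le_all_eq0 => e e0.
have e2 : 0 < e / 2 by rewrite divr_gt0.
have [N hN] := h _ e2; have [N' hN'] := h' _ e2.
have -> : e = e / 2 + e / 2 by lra.
have -> : l - l' = (t (N + N')%N - l') - (t (N + N')%N - l).
  by rewrite opprB [RHS]addrC addrA subrK.
by apply: norm_leB; [apply: hN'; rewrite leq_addl|apply: hN; rewrite leq_addr].
Qed.

Lemma convergesD t s l k :
  converges t l -> converges s k -> converges (fun n => t n + s n) (l + k).
Proof.
move=> h h' e e0; have e2 : 0 < e / 2 by rewrite divr_gt0.
have [N hN] := h _ e2; have [N' hN'] := h' _ e2; exists (N + N')%N => n Nn.
have -> : e = e / 2 + e / 2 by lra.
rewrite opprD addrACA; apply: norm_leD.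
  by apply: hN; apply: leq_trans Nn; rewrite leq_addr.
by apply: hN'; apply: leq_trans Nn; rewrite leq_addl.
Qed.

Lemma converges_mull c t l : converges t l -> converges (fun n => c * t n) (c * l).
Proof.
have [M cM] := norm_le_ex c; have M0 := norm_le_ge0 cM => h e e0.
have M1 : 0 < M + 1 by rewrite ltr_wpDl.
have [N hN] := h _ (divr_gt0 e0 M1); exists N => n Nn; rewrite -mulrBr.
apply: norm_leW (norm_leM cM (hN n Nn)).
by rewrite mulrCA ger_pMr // ler_pdivrMr // mul1r lerDl.
Qed.

Lemma converges_ustar t l : converges t l -> converges (fun n => ustar (t n)) (ustar l).
Proof.
move=> h e e0; have [N hN] := h e e0; exists N => n Nn /=; rewrite -ustarB.
exact/norm_le_ustar/hN.
Qed.

Lemma converges_mulr c t l : converges t l -> converges (fun n => t n * c) (l * c).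
Proof.
move=> h; have := converges_ustar (converges_mull (ustar c) (converges_ustar h)).
rewrite ustarM !ustarK; congr (converges _ _); apply/funext => n /=.
by rewrite ustarM !ustarK.
Qed.

Lemma convergesM t s l k M : (forall n, norm_le (t n) M) ->
  converges t l -> converges s k -> converges (fun n => t n * s n) (l * k).
Proof.
move=> tM h h'; have M0 := norm_le_ge0 (tM 0%N).
have M1 : 0 < M + 1 by rewrite ltr_wpDl.
have -> : (fun n => t n * s n) = fun n => t n * (s n - k) + t n * k.
  by apply/funext => n; rewrite mulrBr subrK.
rewrite -[l * k]add0r; apply: convergesD; last exact: converges_mulr.
move=> e e0; have [N hN] := h' _ (divr_gt0 e0 M1); exists N => n Nn; rewrite subr0.
apply: norm_leW (norm_leM (tM n) (hN n Nn)).
by rewrite mulrCA ger_pMr // ler_pdivrMr // mul1r lerDl.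
Qed.

Lemma converges_shift t l : converges t l -> converges (fun n => t n.+1) l.
Proof.
move=> h e e0; have [N hN] := h e e0; exists N => n Nn; apply: hN.
exact: leqW.
Qed.

Lemma converges_cst l : converges (fun _ => l) l.
Proof. by move=> e e0; exists 0%N => n _; rewrite subrr; apply: norm_le0; exact: ltW. Qed.

Lemma convergesZ (z : C) t l : converges t l -> converges (fun n => z *: t n) (z *: l).
Proof.
move=> /(converges_mull z%:A); rewrite -scalerAl mul1r; congr converges.
by apply/funext => n; rewrite -scalerAl mul1r.
Qed.

End Unitization.

Lemma addr_add_sub (V : zmodType) (a b : V) : (a + b) + (a - b) = a + a.
Proof. by rewrite addrACA subrr addr0. Qed.

(** * Square roots and positive elements *)

Section SquareRoots.
Variables (T : realType) (A : cstarAlgType T).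
Local Notation C := T[i].
Local Notation U := (unitization A).
Implicit Types u v w x y z : U.

Lemma conj_cc (x : T) : (x%:C%C : C)^* = x%:C%C.
Proof. by apply/conj_Creal; rewrite complex_real. Qed.

Definition half : C := (2^-1 : T)%:C%C.
Lemma half2 : half + half = 1.
Proof. by rewrite /half -ccD -(rmorph1 (real_complex T)); congr (_%:C%C); lra. Qed.

Fixpoint sqrt_iter (w : U) n : U :=
  if n is m.+1 then half *: (w + sqrt_iter w m * sqrt_iter w m) else 0.
Fixpoint sqrt_majorant n : T :=
  if n is m.+1 then 2^-1 * (1 + sqrt_majorant m * sqrt_majorant m) else 0.

Lemma sqrt_majorant_bound n : 0 <= sqrt_majorant n <= 1.
Proof. by elim: n => [|n /andP[h1 h2]] /=; [rewrite lexx ler01|nra]. Qed.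

(* The square root of 1 - w is 1 - t, where t is the limit of the iteration
   t := (w + t^2) / 2.  Its increments are dominated by those of the
   scalar iteration with w = 1, which is increasing and bounded by 1. *)
Lemma sqrt_one_sub w : ustar w = w -> norm_le w 1 ->
  exists v, [/\ ustar v = v, v * v = 1 - w, norm_le (1 - v) 1 &
    forall c, c * w = w * c -> c * v = v * c].
Proof.
move=> aw w1; pose t := sqrt_iter w; pose s := sqrt_majorant.
have at' n : ustar (t n) = t n.
  elim: n => [|n ih] /=; first exact: ustar0.
  by rewrite ustarZ ustarD ustarM ih aw conj_cc.
have ct n c : c * w = w * c -> c * t n = t n * c.
  move=> cw; elim: n => [|n ih] /=; first by rewrite mulr0 mul0r.
  by rewrite -scalerAr -scalerAl mulrDr mulrDl cw -mulrA -ih !mulrA ih.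
have tt m n : t m * t n = t n * t m by apply: (ct); symmetry; exact: ct.
have ts n : norm_le (t n) (s n).
  elim: n => [|n ih]; first exact: norm_le0.
  by apply: norm_leZ; [lra|apply: norm_leD => //; exact: norm_leM].
have dt n : norm_le (t n.+1 - t n) (s n.+1 - s n).
  elim: n => [|n ih].
    rewrite /= !subr0 mulr0 addr0 /t /= mulr0 addr0.
    by apply: norm_leZ; [lra|].
  (* The iterates commute, being polynomials in w, so the difference of their squares factors. *)
  have -> : t n.+2 - t n.+1 = half *: ((t n.+1 - t n) * (t n.+1 + t n)).
    rewrite mulrDr !mulrBl [t n * t n.+1]tt addrA subrK.
    have tE m : t m.+1 = half *: (w + t m * t m) by [].
    by rewrite (tE n.+1) [X in _ - X = _](tE n) -scalerBr opprD addrACA subrr add0r.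
  have -> : s n.+2 - s n.+1 = 2^-1 * ((s n.+1 - s n) * (s n.+1 + s n)).
    have sE m : s m.+1 = 2^-1 * (1 + s m * s m) by [].
    by rewrite (sE n.+1) [X in _ - X = _](sE n); ring.
  by apply: norm_leZ; [lra|apply: norm_leM => //; exact: norm_leD].
have s1 n : s n <= 1 by have /andP[] := sqrt_majorant_bound n.
have [l tl] := converges_increments dt s1.
have t1 n : norm_le (t n) 1 by apply: norm_leW (ts n).
have lE : l = half *: (w + l * l).
  apply: converges_unique (converges_shift tl) _.
  apply: convergesZ; apply: convergesD; first exact: converges_cst.
  exact: (convergesM t1 tl tl).
have l2 : l + l = w + l * l by rewrite {1 2}lE -scalerDl half2 scale1r.
exists (1 - l); split.
- rewrite ustarB ustar1; congr (_ - _); apply: converges_unique (converges_ustar tl) _.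
  by rewrite (_ : (fun n => ustar (t n)) = t) //; apply/funext => n; exact: at'.
- have -> : w = l + l - l * l by rewrite l2 addrK.
  by rewrite mulrBl mul1r mulrBr mulr1 -addrA -opprD addrA.
- by rewrite opprB addrC subrK; exact: (converges_le t1 tl).
move=> c cw; rewrite mulrBl mulrBr mul1r mulr1; congr (_ - _).
apply: converges_unique (converges_mull c tl) _.
rewrite (_ : (fun n => c * t n) = (fun n => t n * c)); first exact: converges_mulr.
by apply/funext => n; exact: ct.
Qed.

Definition imag : C := 'i%C.
Lemma imag2 : imag * imag = -1. Proof. by rewrite -expr2 sqr_i. Qed.
Lemma conj_imag : imag^* = - imag.
Proof. by apply/eqP; rewrite eq_complex /= oppr0 !eqxx. Qed.

Lemma norm_le_cst (r : T) : 0 <= r -> norm_le (r%:C%C *: 1 : U) r.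
Proof. by move=> r0; have := norm_leZ r0 (norm_le1 A); rewrite mulr1. Qed.

(** For u = x + i z one has u* u = x^2 + z^2 = M^2, so |u| <= M, and x is the mean of u and u*. *)
Lemma norm_le_sum_sq x z (M : T) : 0 <= M -> ustar x = x -> ustar z = z ->
  x * z = z * x -> x * x + z * z = (M ^+ 2)%:C%C *: 1 -> norm_le x M.
Proof.
move=> M0 xx zz xz e; pose u := x + imag *: z.
have au : ustar u = x - imag *: z by rewrite ustarD ustarZ conj_imag scaleNr xx zz.
have uM : norm_le u M.
  apply: norm_le_cstar => //; rewrite au mulrBl !mulrDr -!scalerAl -!scalerAr.
  rewrite scalerA imag2 scaleN1r xz opprD opprK addrA addrK e.
  by apply: norm_le_cst; rewrite exprn_ge0.
have -> : x = half *: (u + ustar u).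
  by rewrite au addrACA subrr addr0 scalerDr -scalerDl half2 scale1r.
have -> : M = 2^-1 * (M + M) by lra.
by apply: norm_leZ; [lra|apply: norm_leD => //; exact: norm_le_ustar].
Qed.

(* For a self-adjoint contraction y, y + i sqrt (1 - y^2) is unitary. *)
Lemma norm_le_one_sub_sq y : ustar y = y -> norm_le y 1 -> norm_le (1 - y * y) 1.
Proof.
move=> yy y1; have y2 : norm_le (y * y) 1 by rewrite -[X in norm_le _ X]mulr1; exact: norm_leM.
have [|v [vv v2 _ cv]] := sqrt_one_sub _ y2; first by rewrite ustarM yy.
rewrite -v2 -[X in norm_le _ X]mulr1; have v1 : norm_le v 1; last exact: norm_leM.
apply: (@norm_le_sum_sq _ y) => //; first by symmetry; apply: cv; rewrite mulrA.
by rewrite v2 subrK expr1n scale1r.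
Qed.

(* The norm criterion for positivity; it makes sums of positive elements
   positive without any spectral theory. *)
Definition positive x : Prop :=
  ustar x = x /\ exists M : T, norm_le (M%:C%C *: 1 - x) M.

Lemma positive_herm x : positive x -> ustar x = x. Proof. by case. Qed.

Lemma positiveD x y : positive x -> positive y -> positive (x + y).
Proof.
move=> [xx [M xM]] [yy [N yN]]; split; first by rewrite ustarD xx yy.
by exists (M + N); rewrite ccD scalerDl opprD addrACA; exact: norm_leD.
Qed.

Lemma positiveZ (r : T) x : 0 <= r -> positive x -> positive (r%:C%C *: x).
Proof.
move=> r0 [xx [M xM]]; split; first by rewrite ustarZ xx conj_cc.
by exists (r * M); rewrite ccM -scalerA -scalerBr; exact: norm_leZ.
Qed.

Lemma positive0 : positive 0.
Proof. by split; [exact: ustar0|exists 0; rewrite scale0r subrr; exact: norm_le0]. Qed.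

Lemma positive_sum I (r : seq I) (F : I -> U) :
  (forall i, positive (F i)) -> positive (\sum_(i <- r) F i).
Proof.
by move=> h; elim/big_ind: _ => //; [exact: positive0|exact: positiveD].
Qed.

Lemma norm_le_ex_gt0 x : exists2 K : T, 0 < K & norm_le x K.
Proof.
have [K hK] := norm_le_ex x; have K0 := norm_le_ge0 hK.
by exists (K + 1); [rewrite ltr_wpDl|apply: norm_leW hK; rewrite lerDl].
Qed.

(** For a contraction y, [norm_le_one_sub_sq] is the criterion with M = 1; the general case follows
    by scaling. *)
Lemma positive_sq y : ustar y = y -> positive (y * y).
Proof.
move=> yy; have [K K0 yK] := norm_le_ex_gt0 y.
have Ki : 0 <= K^-1 by rewrite invr_ge0 ltW.
have := norm_leZ Ki yK; rewrite mulVf ?gt_eqF // => /norm_le_one_sub_sq.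
rewrite ustarZ yy conj_cc => /(_ erefl) h.
have -> : y * y = (K ^+ 2)%:C%C *: ((K^-1%:C%C *: y) * (K^-1%:C%C *: y)).
  rewrite -scalerAl -scalerAr !scalerA -!ccM expr2.
  by rewrite mulfK ?gt_eqF // divff ?gt_eqF // scale1r.
apply: positiveZ; first by rewrite exprn_ge0 ?ltW.
by split; [rewrite ustarM ustarZ yy conj_cc|exists 1; rewrite scale1r].
Qed.

(** Write x = M (1 - w) with the contraction w = (M - x) / M; the root is sqrt M times the root of 1
    - w. For M = 0 the criterion forces x = 0. *)
Lemma positive_sqrt x : positive x -> exists h,
  [/\ positive h, h * h = x & forall c, c * x = x * c -> c * h = h * c].
Proof.
move=> [xx [M xM]]; have [M0|M0] := eqVneq M 0.
  have x0 : x = 0.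
    by apply/eqP; rewrite -oppr_eq0; move: xM; rewrite M0 scale0r add0r => /norm_le_eq0 ->.
  by exists 0; split; rewrite ?x0 ?mulr0 //; exact: positive0.
have Mp : 0 < M by rewrite lt_neqAle eq_sym M0 (norm_le_ge0 xM).
have Mi : 0 <= M^-1 by rewrite invr_ge0 ltW.
have := norm_leZ Mi xM; rewrite mulVf // => /sqrt_one_sub.
case=> [|v [vv v2 v1 cv]]; first by rewrite ustarZ ustarB ustarZ ustar1 xx !conj_cc.
have w1 : 1 - M^-1%:C%C *: (M%:C%C *: 1 - x) = M^-1%:C%C *: x.
  by rewrite scalerBr scalerA -ccM mulVf // scale1r opprB addrC subrK.
exists ((Num.sqrt M)%:C%C *: v); split.
- apply: positiveZ; first exact: sqrtr_ge0.
  by split=> //; exists 1; rewrite scale1r.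
- rewrite -scalerAl -scalerAr v2 w1 !scalerA -!ccM -expr2 sqr_sqrtr ?ltW //.
  by rewrite divff // scale1r.
move=> c cx; rewrite -scalerAl -scalerAr cv // -scalerAl -scalerAr.
by rewrite mulrBl mulrBr -scalerAl -scalerAr mul1r mulr1 cx.
Qed.

Lemma abs_sqrt y : ustar y = y -> exists j q, [/\ positive j, positive q,
  j * j = y * y, q * q = j & forall c, c * y = y * c -> c * j = j * c /\ c * q = q * c].
Proof.
move=> yy; have [j [jp j2 cj]] := positive_sqrt (positive_sq yy).
have [q [qp q2 cq]] := positive_sqrt jp; exists j, q; split=> // c cy.
have cj' : c * j = j * c by apply: cj; rewrite mulrA cy -mulrA cy mulrA.
by split=> //; exact: cq.
Qed.

(** The roots h of z and g of r^2 - z commute and h^2 + g^2 = r^2, so [norm_le_sum_sq] bounds h by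
    r. *)
Lemma positive_norm_le z (r : T) : 0 <= r -> positive z ->
  positive ((r ^+ 2)%:C%C *: 1 - z) -> norm_le z (r ^+ 2).
Proof.
move=> r0 zp /positive_sqrt[g [gp g2 cg]].
have [h [hp h2 ch]] := positive_sqrt zp.
suff hr : norm_le h r by rewrite -h2 expr2; exact: norm_leM.
apply: (@norm_le_sum_sq _ g) => //; try exact: positive_herm.
  apply: cg; rewrite mulrBl mulrBr -scalerAl -scalerAr mul1r mulr1 -h2.
  by rewrite mulrA.
by rewrite h2 g2 addrC subrK.
Qed.

Lemma positive_anti x : positive x -> positive (- x) -> x = 0.
Proof.
move=> xp nxp; apply: norm_le_eq0; have := @positive_norm_le x 0.
by rewrite expr0n scale0r add0r; exact.
Qed.

Lemma ustar_mul_eq0 x : ustar x * x = 0 -> x = 0.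
Proof.
move=> h; apply/norm_le_eq0/norm_le_cstar => //.
by rewrite h expr0n; exact: norm_le0.
Qed.

Lemma sq_eq0 x : ustar x = x -> x * x = 0 -> x = 0.
Proof. by move=> xx h; apply: ustar_mul_eq0; rewrite xx. Qed.

(** This is half the sum of the squares of the self-adjoint elements n + n* and i n - i n*. *)
Lemma positive_add_star n : positive (ustar n * n + n * ustar n).
Proof.
set s := ustar n; have ss : ustar s = n by exact: ustarK.
have -> : s * n + n * s = half *: ((n + s) * (n + s) + (imag *: (n - s)) * (imag *: (n - s))).
  rewrite -scalerAl -scalerAr scalerA imag2 scaleN1r !mulrBl !mulrBr !mulrDl !mulrDr.
  rewrite !opprB.
  rewrite [s * n - _ + _]addrC addrACA [n * n + n * s]addrC !addr_add_sub.
  by rewrite addrACA scalerDr -scalerDl half2 scale1r addrC.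
apply: positiveZ; first by rewrite invr_ge0.
by apply: positiveD; apply: positive_sq;
   rewrite ?ustarZ ?ustarB ?ustarD ss -/s ?conj_imag ?scaleNr -?scalerN ?opprB // addrC.
Qed.

(* Kaplansky: if h is the negative part of x* x and n = x h, then n* n is the
   opposite of a square k^2, and both N* N and N N* are for N = n k, which
   forces k = 0 since N* N + N N* is positive. *)
Lemma positive_star_mul x : positive (ustar x * x).
Proof.
set h := ustar x * x; have hh : ustar h = h by rewrite ustarM ustarK.
have [j [q [jp qp j2 q2 cjq]]] := abs_sqrt hh.
have [jj qq] := (positive_herm jp, positive_herm qp).
have [hj hq] := cjq h erefl; pose m := j - h.
have qj : q * j = j * q by rewrite -q2 mulrA.
have qm : q * m = m * q by rewrite mulrBr mulrBl qj hq.
have mm : ustar m = m by rewrite ustarB jj hh.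
have hm : h * m = - (j * m) by rewrite /m !mulrBr hj j2 opprB.
pose n := x * m; pose k := q * m.
have kk : ustar k = k by rewrite ustarM mm qq.
have nn : ustar n * n = - (k * k).
  rewrite ustarM mm -mulrA (mulrA (ustar x)) -/h hm mulrN; congr (- _).
  by rewrite /k {1}qm -q2 !mulrA.
have kE : k = q * m by []; clearbody n k.
have [l [lp l2 _]] : exists l, [/\ positive l, l * l = n * ustar n &
    forall c, c * (n * ustar n) = n * ustar n * c -> c * l = l * c].
  apply: positive_sqrt.
  have -> : n * ustar n = (ustar n * n + n * ustar n) + k * k by rewrite nn addrAC addNr add0r.
  by apply: positiveD (positive_add_star n) (positive_sq kk).
have ll := positive_herm lp.
pose N := n * k.
have N1 : ustar N * N = - ((k * k) * (k * k)).
  by rewrite /N ustarM kk -!mulrA (mulrA (ustar n)) nn mulNr mulrN !mulrA.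
have N2 : N * ustar N = - ((l * l) * (l * l)).
  by rewrite l2 /N ustarM kk -!mulrA (mulrA k) -[k * k]opprK -nn mulNr mulrN !mulrA.
have kp : positive (k * k * (k * k)) by apply: positive_sq; rewrite ustarM kk.
have lp' : positive (l * l * (l * l)) by apply: positive_sq; rewrite ustarM ll.
have k4 : k * k * (k * k) = 0.
  apply: positive_anti => //.
  have := positive_add_star N; rewrite N1 N2 -opprD => /(positive_anti (positiveD kp lp')).
  by move=> /eqP; rewrite addr_eq0 => /eqP ->; rewrite opprK.
have k0 : k = 0 by apply: sq_eq0 => //; apply: sq_eq0 => //; rewrite ustarM kk.
have jm : j * m = 0 by rewrite -q2 -mulrA -kE k0 mulr0.
have m0 : m = 0.
  by apply: sq_eq0 => //; rewrite {1}/m mulrBl hm jm oppr0 subrr.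
by move: m0 => /eqP; rewrite subr_eq0 => /eqP <-.
Qed.

Lemma positive_conj c x : positive x -> positive (ustar c * x * c).
Proof.
move=> /positive_sqrt[h [hp <- _]].
have -> : ustar c * (h * h) * c = ustar (h * c) * (h * c).
  by rewrite ustarM (positive_herm hp) !mulrA.
exact: positive_star_mul.
Qed.

Lemma positive_sub_norm x M : ustar x = x -> norm_le x M -> positive (M%:C%C *: 1 - x).
Proof.
move=> xx xM; split; first by rewrite ustarB ustarZ ustar1 conj_cc xx.
(* The criterion holds with constant 2M: subtracting M - x from 2M leaves M + x, of norm at most
   2M. *)
have M0 := norm_le_ge0 xM; exists (M + 0 + M).
have -> : (M + 0 + M)%:C%C *: 1 - (M%:C%C *: 1 - x) = M%:C%C *: 1 + x.
  by rewrite addr0 ccD scalerDl opprB addrA addrAC addrK.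
by rewrite addr0; apply: norm_leD => //; exact: norm_le_cst.
Qed.

(* With w = 1 - k^2, one has 1 - w^n - n w^n k^2 >= 0 by induction on n, the
   increment being (n + 1) w^n k^4; hence n w^n k^2 <= 1. *)
Lemma approximate_unit k : ustar k = k -> norm_le k 1 -> exists g : U,
  [/\ ustar g = g, g * g = 1 - k * k, g * k = k * g &
   forall e : T, 0 < e -> exists n, norm_le ((g * g) ^+ n * k) e].
Proof.
move=> kk k1; have k2 : norm_le (k * k) 1.
  by rewrite -[X in norm_le _ X]mulr1; exact: norm_leM.
have wp : positive (1 - k * k).
  by have := positive_sub_norm _ k2; rewrite scale1r ustarM kk; exact.
have [g [gp g2 cg]] := positive_sqrt wp; have gg := positive_herm gp.
have gk : g * k = k * g by symmetry; apply: cg; rewrite mulrBl mulrBr mul1r mulr1 mulrA.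
exists g; split=> // e e0; pose W n := (g * g) ^+ n.
have gnk n : g ^+ n * k = k * g ^+ n by symmetry; apply: commrX; rewrite /GRing.comm gk.
have WE n : W n = g ^+ n * g ^+ n by rewrite /W -expr2 -exprM mul2n -addnn exprD.
have Wk n : W n * k = k * W n by rewrite WE -mulrA gnk mulrA gnk mulrA.
have aX n : ustar (g ^+ n) = g ^+ n by rewrite ustarX gg.
have Wp n : positive (W n) by rewrite WE; exact: positive_sq.
have Wkkp n : positive (W n * (k * k)).
  have -> : W n * (k * k) = (g ^+ n * k) * (g ^+ n * k).
    by rewrite WE -!mulrA; congr (_ * _); rewrite !mulrA gnk.
  by apply: positive_sq; rewrite ustarM kk aX gnk.
have Wkkkkp n : positive (W n * (k * k) * (k * k)).
  have -> : W n * (k * k) * (k * k) = ustar k * (W n * (k * k)) * k.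
    by rewrite kk -!mulrA !(mulrA k) !(mulrA (W n)) Wk !mulrA.
  exact: positive_conj.
have Dp n : positive (1 - W n - n%:R%:C%C *: (W n * (k * k))).
  elim: n => [|n ih].
    by rewrite /W expr0 subrr scale0r subrr; exact: positive0.
  have WS : W n.+1 = W n - W n * (k * k) by rewrite /W exprSr g2 mulrBr mulr1.
  rewrite WS mulrBl; set x := W n * (k * k) in ih *.
  have := positiveD ih (positiveZ (ler0n T n.+1) (Wkkkkp n)); rewrite -/x.
  congr positive; rewrite scalerBr -[X in _ = _ - (X%:C%C *: _ - _)]natr1 ccD scalerDl scale1r.
  rewrite !opprB addrCA [RHS]addrC; congr (_ + _).
  by rewrite opprD [x - _]addrC !addrA [RHS]addrAC addrK.
have nW n : norm_le (n%:R%:C%C *: (W n * (k * k))) 1.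
  rewrite -(expr1n T 2); apply: positive_norm_le => //; first exact: positiveZ.
  rewrite expr1n scale1r; have := positiveD (Dp n) (Wp n).
  by rewrite addrAC subrK.
have [n nP] : exists n, (e ^- 2) <= n%:R :> T.
  by exists (Num.bound (e ^- 2)); apply/ltW/archi_boundP; rewrite invr_ge0 exprn_ge0 ?ltW.
have n0 : 0 < n%:R :> T by apply: lt_le_trans nP; rewrite invr_gt0 exprn_gt0.
have nn0 : (n + n)%:R != 0 :> T by rewrite natrD gt_eqF // addr_gt0.
(* By the C*-identity it is enough to bound w^(2n) k^2, where w = g^2; it is at most 1/(2n) <= 1/n
   <= e^2. *)
exists n; apply: norm_le_cstar (ltW e0) _.
have -> : ustar (W n * k) * (W n * k) =
    (n + n)%:R^-1%:C%C *: ((n + n)%:R%:C%C *: (W (n + n)%N * (k * k))).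
  rewrite scalerA -ccM mulVf ?scale1r //.
  rewrite ustarM kk (positive_herm (Wp n)) -!mulrA (mulrA (W n)) -exprD -/(W _).
  by rewrite mulrA -Wk mulrA.
have := norm_leZ _ (nW (n + n)%N); move=> /(_ (n + n)%:R^-1); rewrite mulr1 => h.
apply: norm_leW (h _); last by rewrite invr_ge0 ler0n.
rewrite -[e ^+ 2]invrK lef_pV2 ?posrE ?invr_gt0 ?exprn_gt0 ?natrD ?addr_gt0 //.
by rewrite (le_trans nP) // lerDl ltW.
Qed.

(** The terms are g^(2i) (1 - g^2), so the sum telescopes. *)
Lemma sum_conj_geometric (g x : U) n : g * x = x * g -> x = 1 - g * g ->
  \sum_(i < n) g ^+ i * x * g ^+ i = 1 - (g * g) ^+ n.
Proof.
move=> gx xE; elim: n => [|n ih]; first by rewrite big_ord0 expr0 subrr.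
rewrite big_ord_recr /= ih -(commrX n (esym gx)) -mulrA -exprD addnn -mul2n exprM expr2.
by rewrite {1}xE mulrBl mul1r -exprS addrA subrK.
Qed.

End SquareRoots.

(** * Morita contexts *)

Section Spans.
Variables (C : numClosedFieldType) (V : lmodType C).

Lemma lspanD (G : set V) x y : lspan G x -> lspan G y -> lspan G (x + y).
Proof.
move=> [s sG ->] [t tG ->]; exists (s ++ t); last by rewrite big_cat.
by move=> p; rewrite mem_cat => /orP[]; [exact: sG|exact: tG].
Qed.

Lemma lspanZ (G : set V) c x : G x -> lspan G (c *: x).
Proof.
move=> Gx; exists [:: (c, x)]; last by rewrite big_seq1.
by move=> p; rewrite inE => /eqP ->.
Qed.

Lemma lspan_scale (G : set V) c x : lspan G x -> lspan G (c *: x).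
Proof.
move=> [s sG ->]; exists [seq (c * p.1, p.2) | p <- s].
  by move=> _ /mapP[p ps ->]; exact: (sG p ps).
by rewrite big_map scaler_sumr; apply: eq_bigr => p _; rewrite scalerA.
Qed.

Lemma lspan0 (G : set V) : lspan G 0.
Proof. by exists [::]; rewrite ?big_nil. Qed.

Lemma lspan_ind (G : set V) (K : V -> Prop) : lspan G = [set: V] ->
  K 0 -> (forall x y, K x -> K y -> K (x + y)) ->
  (forall (c : C) x, G x -> K (c *: x)) -> forall x, K x.
Proof.
move=> GT K0 KD KG x; have : lspan G x by rewrite GT.
case=> s sG ->; elim: s sG => [|p s ih] sG; first by rewrite big_nil.
rewrite big_cons; apply: KD; first by apply: KG; apply: sG; rewrite mem_head.
by apply: ih => q qs; apply: sG; rewrite inE qs orbT.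
Qed.

(** The sum f x y + f y x is a combination of diagonal values, and replacing y by i y then isolates
    f x y. The constant c is i or -i according to whether f is linear in its second or its first
    argument. *)
Lemma polarization_ind (W : lmodType C) (D : set W) (f : W -> W -> V) (c : C)
    (K : V -> Prop) :
  (forall x y, K x -> K y -> K (x + y)) -> (forall a x, K x -> K (a *: x)) ->
  (forall x y, D x -> D y -> D (x + y)) -> (forall x, D x -> D ('i *: x)) ->
  (forall x y z, f x (y + z) = f x y + f x z) ->
  (forall x y z, f (x + y) z = f x z + f y z) ->
  (forall x y, f x ('i *: y) = c *: f x y) ->
  (forall x y, f ('i *: x) y = - c *: f x y) -> c != 0 ->
  (forall x, D x -> K (f x x)) -> forall x y, D x -> D y -> K (f x y).
Proof.
move=> KD KZ DD DZ fDr fDl fZr fZl c0 Kf x y Dx Dy.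
have KB a b : K a -> K b -> K (a - b).
  by move=> ? ?; rewrite -scaleN1r; apply: (KD) => //; exact: KZ.
have sym a b : D a -> D b -> K (f a b + f b a).
  move=> Da Db; have -> : f a b + f b a = f (a + b) (a + b) - f a a - f b b.
    by rewrite !fDr !fDl -addrA -opprD [f a b + f b b]addrC addrACA [RHS]addrAC subrr add0r addrC.
  by apply: (KB); [apply: (KB)|]; apply: (Kf) => //; exact: DD.
have -> : f x y = 2^-1 *: ((f x y + f y x) + c^-1 *: (f x ('i *: y) + f ('i *: y) x)).
  rewrite fZr fZl scaleNr -scalerBr scalerA mulVf // scale1r addrACA subrr addr0.
  have -> : f x y + f x y = 2 *: f x y by rewrite scaler_nat mulr2n.
  by rewrite scalerA mulVf ?scale1r // pnatr_eq0.
by apply: (KZ); apply: (KD); [exact: sym|apply: (KZ); apply: sym => //; exact: DZ].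
Qed.

End Spans.

Section ModuleTheory.
Variables (C : numClosedFieldType) (S R : starAlgType C) (X : bimodType S R).
Implicit Types (x y z : X) (r : R) (s : S).

Lemma ract0l r : 0 ◃ r = 0 :> X.
Proof. by rewrite -(scale0r 0) ractZl !scale0r. Qed.
Lemma ract0r x : x ◃ 0 = 0. Proof. by rewrite -(scale0r 0) ractZr !scale0r. Qed.
Lemma lact0l x : 0 ▹ x = 0. Proof. by rewrite -(scale0r 0) lactZl !scale0r. Qed.
Lemma lact0r s : s ▹ 0 = 0 :> X.
Proof. by rewrite -(scale0r 0) lactZr !scale0r. Qed.

(** An equivalence bimodule stripped of positivity, with nondegeneracy conditions instead. They are
    listed for both sides so that the notion is stable under conjugation. *)
Record Morita_context (ipR : X -> X -> R) (ipS : X -> X -> S) : Prop := {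
  mc_ipR : right_inner_product ipR;
  mc_ipS : left_inner_product ipS;
  mc_fullR : ip_full ipR;
  mc_fullS : ip_full ipS;
  mc_adjR : forall s x y, ipR (s ▹ x) y = ipR x (star s ▹ y);
  mc_adjS : forall r x y, ipS (x ◃ r) y = ipS x (y ◃ star r);
  mc_compat : forall x y z, x ◃ ipR y z = ipS x y ▹ z;
  mc_ndR : forall x, (forall y, ipR x y = 0) -> x = 0;
  mc_ndS : forall x, (forall y, ipS x y = 0) -> x = 0;
  mc_spanR : lspan [set x : X | exists y r, x = y ◃ r] = [set: X];
  mc_spanS : lspan [set x : X | exists s y, x = s ▹ y] = [set: X]
}.

Variables (ipR : X -> X -> R) (ipS : X -> X -> S).
Hypothesis mc : Morita_context ipR ipS.

Lemma mcRD x y z : ipR x (y + z) = ipR x y + ipR x z.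
Proof. exact: ripD (mc_ipR mc) _ _ _. Qed.
Lemma mcRZ c x y : ipR x (c *: y) = c *: ipR x y.
Proof. exact: ripZ (mc_ipR mc) _ _ _. Qed.
Lemma mcRA x y r : ipR x (y ◃ r) = ipR x y ⋅ r.
Proof. exact: ripA (mc_ipR mc) _ _ _. Qed.
Lemma mcRC x y : star (ipR y x) = ipR x y.
Proof. by rewrite -(ripC (mc_ipR mc)). Qed.
Lemma mcRDl x y z : ipR (x + y) z = ipR x z + ipR y z.
Proof. by rewrite -mcRC mcRD starD !mcRC. Qed.
Lemma mcRZl c x y : ipR (c *: x) y = c^* *: ipR x y.
Proof. by rewrite -mcRC mcRZ starZ mcRC. Qed.
Lemma mcRAl x y r : ipR (x ◃ r) y = star r ⋅ ipR x y.
Proof. by rewrite -mcRC mcRA starM mcRC. Qed.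
Lemma mcR0 x : ipR x 0 = 0. Proof. by rewrite -(scale0r 0) mcRZ scale0r. Qed.
Lemma mcR0l x : ipR 0 x = 0. Proof. by rewrite -mcRC mcR0 star_0. Qed.
Lemma mcRN x y : ipR x (- y) = - ipR x y.
Proof. by rewrite -scaleN1r mcRZ scaleN1r. Qed.
Lemma mcRNl x y : ipR (- x) y = - ipR x y.
Proof. by rewrite -mcRC mcRN star_N mcRC. Qed.

Lemma mcSD x y z : ipS (x + y) z = ipS x z + ipS y z.
Proof. exact: lipD (mc_ipS mc) _ _ _. Qed.
Lemma mcSZ c x y : ipS (c *: x) y = c *: ipS x y.
Proof. exact: lipZ (mc_ipS mc) _ _ _. Qed.
Lemma mcSA s x y : ipS (s ▹ x) y = s ⋅ ipS x y.
Proof. exact: lipA (mc_ipS mc) _ _ _. Qed.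
Lemma mcSC x y : star (ipS y x) = ipS x y.
Proof. by rewrite -(lipC (mc_ipS mc)). Qed.
Lemma mcSDr x y z : ipS x (y + z) = ipS x y + ipS x z.
Proof. by rewrite -mcSC mcSD starD !mcSC. Qed.
Lemma mcSZr c x y : ipS x (c *: y) = c^* *: ipS x y.
Proof. by rewrite -mcSC mcSZ starZ mcSC. Qed.
Lemma mcSAr s x y : ipS x (s ▹ y) = ipS x y ⋅ star s.
Proof. by rewrite -mcSC mcSA starM mcSC. Qed.
Lemma mcSN x y : ipS (- x) y = - ipS x y.
Proof. by rewrite -scaleN1r mcSZ scaleN1r. Qed.
Lemma mcSNr x y : ipS x (- y) = - ipS x y.
Proof. by rewrite -mcSC mcSN star_N mcSC. Qed.

End ModuleTheory.

(** Exchanges the roles of R and S, so that results on one inner product transfer to the other. *)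
Lemma Morita_context_conj (C : numClosedFieldType) (S R : starAlgType C)
    (X : bimodType S R) (ipR : X -> X -> R) (ipS : X -> X -> S) :
  Morita_context ipR ipS ->
  @Morita_context C R S (conjmod X) (conj_ip ipS) (fun x y => ipR (of_conj x) (of_conj y)).
Proof.
move=> mc; split.
- split=> [x y z|c x y|x y r|x y]; rewrite /conj_ip.
  + exact: (mcSDr mc).
  + by have := mcSZr mc c^* (of_conj x) (of_conj y); rewrite conjCK.
  + by have := mcSAr mc (star r) (of_conj x) (of_conj y); rewrite starK.
  + by rewrite (mcSC mc).
- split=> [x y z|c x y|s x y|x y].
  + exact: (mcRDl mc).
  + by have := mcRZl mc c^* (of_conj x) (of_conj y); rewrite conjCK.
  + by have := mcRAl mc (of_conj x) (of_conj y) (star s); rewrite starK.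
  + by rewrite (mcRC mc).
- exact: mc_fullS mc.
- exact: mc_fullR mc.
- by move=> s x y; rewrite /conj_ip; have := mc_adjS mc (star s) (of_conj x) (of_conj y).
- by move=> r x y; have := mc_adjR mc (star r) (of_conj x) (of_conj y).
- move=> x y z; rewrite /conj_ip.
  have := mc_compat mc (of_conj z) (of_conj y) (of_conj x).
  by rewrite -(mcRC mc (of_conj y)) -(mcSC mc (of_conj z)); exact: esym.
- exact: mc_ndS mc.
- exact: mc_ndR mc.
- apply/seteqP; split=> // x _.
  apply: (@lspan_ind _ X _ (fun x => @lspan C (conjmod X) _ x) (mc_spanS mc)).
  + exact: (lspan0 (V := conjmod X)).
  + by move=> y z; exact: (lspanD (V := conjmod X)).
  + move=> c _ [s [{}x ->]].
    have -> : c *: (s ▹ x) = c^* *: (to_conj x ◃ star s) :> conjmod X.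
      by rewrite [RHS]/(_ *: _) /= /conj_scale /of_conj /to_conj conjCK /ract /= /conj_ract starK.
    by apply: lspanZ; exists (to_conj x), (star s).
- apply/seteqP; split=> // x _.
  apply: (@lspan_ind _ X _ (fun x => @lspan C (conjmod X) _ x) (mc_spanR mc)).
  + exact: (lspan0 (V := conjmod X)).
  + by move=> y z; exact: (lspanD (V := conjmod X)).
  + move=> c _ [{}x [r ->]].
    have -> : c *: (x ◃ r) = c^* *: (star r ▹ to_conj x) :> conjmod X.
      by rewrite [RHS]/(_ *: _) /= /conj_scale /of_conj /to_conj conjCK /lact /= /conj_lact starK.
    by apply: lspanZ; exists (star r), (to_conj x).
Qed.

(** * Ideals in C*-algebras *)

(** What is retained of a Pedersen ideal. The image is stable under the involution, so the left
    ideal condition makes it a two-sided ideal. *)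
Record ideal_embedding (T : realType) (A : cstarAlgType T) (R : starAlgType T[i])
    (i : R -> A) : Prop := {
  embI : injective i;
  embD : forall r s, i (r + s) = i r + i s;
  embZ : forall (z : T[i]) r, i (z *: r) = z *: i r;
  embM : forall r s, i (r ⋅ s) = i r ⋅ i s;
  emb_star : forall r, i (star r) = star (i r);
  emb_ideal : forall a r, exists r', i r' = a ⋅ i r
}.

Section Embedding.
Variables (T : realType) (A : cstarAlgType T) (R : starAlgType T[i]).
Variables (i : R -> A) (iP : ideal_embedding i).
Local Notation U := (unitization A).
Implicit Types (r s : R) (u v : U).

Definition emb (r : R) : U := incl (i r).

Lemma emb_inj : injective emb. Proof. by move=> r s /incl_inj/(embI iP). Qed.
Lemma emb_add r s : emb (r + s) = emb r + emb s.
Proof. by rewrite /emb (embD iP) inclD. Qed.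
Lemma emb_scale (z : T[i]) r : emb (z *: r) = z *: emb r.
Proof. by rewrite /emb (embZ iP) inclZ. Qed.
Lemma emb_mul r s : emb (r ⋅ s) = emb r * emb s.
Proof. by rewrite /emb (embM iP) inclM. Qed.
Lemma emb_ustar r : emb (star r) = ustar (emb r).
Proof. by rewrite /emb (emb_star iP) incl_star. Qed.
Lemma emb0 : emb 0 = 0.
Proof. by rewrite -(scale0r (0 : R)) emb_scale scale0r. Qed.
Lemma emb_opp r : emb (- r) = - emb r.
Proof. by rewrite -scaleN1r emb_scale scaleN1r. Qed.

Lemma unitz_lmul_ex u r : exists s, emb s = u * emb r.
Proof.
have [s sE] := emb_ideal iP u.2 r; exists (u.1 *: r + s).
by rewrite /emb -incl_mact (embD iP) (embZ iP) sE.
Qed.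
Definition unitz_lmul u r := projT1 (cid (unitz_lmul_ex u r)).
Definition unitz_rmul r u := star (unitz_lmul (ustar u) (star r)).

Lemma unitz_lmulE u r : emb (unitz_lmul u r) = u * emb r.
Proof. exact: projT2 (cid (unitz_lmul_ex u r)). Qed.
Lemma unitz_rmulE r u : emb (unitz_rmul r u) = emb r * u.
Proof. by rewrite emb_ustar unitz_lmulE ustarM -emb_ustar ustarK starK. Qed.

Lemma emb_star_mul_eq0 r : star r ⋅ r = 0 -> r = 0.
Proof.
move=> h; apply: emb_inj; rewrite emb0; apply: ustar_mul_eq0.
by rewrite -emb_ustar -emb_mul h emb0.
Qed.

Definition emb_positive r := positive (emb r).

Lemma emb_positive_star_mul r : emb_positive (star r ⋅ r).
Proof. by rewrite /emb_positive emb_mul emb_ustar; exact: positive_star_mul. Qed.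

Lemma emb_positive_anti r : emb_positive r -> emb_positive (- r) -> r = 0.
Proof.
rewrite /emb_positive emb_opp => h k; apply: emb_inj; rewrite emb0.
exact: positive_anti.
Qed.

End Embedding.

(** * Signed parts of a self-adjoint element *)

Definition sgn (V : zmodType) (b : bool) (v : V) : V := if b then v else - v.

Lemma sgnK (V : zmodType) b : involutive (@sgn V b).
Proof. by case: b => v //=; rewrite opprK. Qed.

Section SignedParts.
Variables (T : realType) (B : cstarAlgType T).
Local Notation UB := (unitization B).
Implicit Types (p j q : UB) (b : bool).

Lemma sgnMl b p j : sgn b p * j = sgn b (p * j).
Proof. by case: b; rewrite /= ?mulNr. Qed.
Lemma sgnMr b p j : j * sgn b p = sgn b (j * p).
Proof. by case: b; rewrite /= ?mulrN. Qed.

(* j = |p| with its square root q; then sgn_part b p j is twice the positive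
   part of p for b = true, and twice the negative part for b = false. *)
Record abs_data p j q : Prop := {
  abs_herm : ustar p = p;
  abs_pos : positive j;
  abs_rootpos : positive q;
  abs_sq : j * j = p * p;
  abs_root : q * q = j;
  abs_comm : p * j = j * p;
  abs_rootcomm : p * q = q * p
}.

Lemma abs_data_ex p : ustar p = p -> exists jq : UB * UB, abs_data p jq.1 jq.2.
Proof.
move=> pp; have [j [q [jp qp j2 q2 c]]] := abs_sqrt pp; exists (j, q).
by have [] := c p erefl; split.
Qed.

Definition sgn_part b p j := j + sgn b p.

Section Parts.
Variables (p j q : UB) (b : bool).
Hypothesis d : abs_data p j q.
Local Notation P := (sgn_part b p j).

Lemma sgn_part_herm : ustar P = P.
Proof.
rewrite ustarD (positive_herm (abs_pos d)); congr (_ + _).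
by case: b; rewrite /= ?ustarN (abs_herm d).
Qed.
Lemma abs_root_abs : q * j = j * q. Proof. by rewrite -(abs_root d) mulrA. Qed.
Lemma sgn_part_root : q * P = P * q.
Proof. by rewrite mulrDr mulrDl sgnMr sgnMl (abs_rootcomm d) abs_root_abs. Qed.
(** On the range of a signed part, p acts as |p| up to the sign; this is p^2 = j^2 rearranged. *)
Lemma sgn_part_mul : p * P = sgn b (j * P).
Proof.
rewrite !mulrDr !sgnMr (abs_comm d) -(abs_sq d); case: b => /=; first exact: addrC.
by rewrite opprB addrC.
Qed.
Lemma sgn_part_sq : P * P = 2 *: (j * P).
Proof.
rewrite {1}/sgn_part mulrDl sgnMl sgn_part_mul; case: b => /=;
by rewrite ?opprK -mulr2n scaler_nat.
Qed.

Lemma sgn_part_opp_eq0 : sgn_part (~~ b) p j = 0 -> sgn b p = j.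
Proof.
by rewrite /sgn_part => /eqP; case: b; rewrite /= ?subr_eq0 ?addr_eq0 => /eqP ->.
Qed.
End Parts.

Lemma sgn_part_sub b p j : sgn_part b p j - sgn_part (~~ b) p j = sgn b (2 *: p).
Proof.
rewrite /sgn_part opprD addrACA subrr add0r.
by case: b; rewrite /= ?opprK ?opprD scaler_nat mulr2n ?opprD.
Qed.

End SignedParts.

(** * The sign of the inner products *)

Section ContextAction.
Variables (T : realType) (A B : cstarAlgType T) (R S : starAlgType T[i]).
Variables (iR : R -> A) (iS : S -> B).
Hypotheses (iRP : ideal_embedding iR) (iSP : ideal_embedding iS).
Variables (X : bimodType S R) (ipR : X -> X -> R) (ipS : X -> X -> S).
Hypothesis mc : Morita_context ipR ipS.
Local Notation UB := (unitization B).
Local Notation eS := (emb iS).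
Local Notation lmul := (unitz_lmul iSP).
Local Notation rmul := (unitz_rmul iSP).
Implicit Types (x y z w : X) (r : R) (s : S) (u v : UB) (b : bool).

Lemma mc_star_ip_eq0 x y : ipR x y ⋅ ipR y x = 0 -> ipR y x = 0.
Proof. by rewrite -(mcRC mc x y); exact: emb_star_mul_eq0 iRP _. Qed.

(** The product <x,y><y,x> = <x, Theta_{y,y} x> vanishes, hence so does <y,x>. *)
Lemma lact_nondeg x : (forall s, s ▹ x = 0) -> x = 0.
Proof.
move=> h; apply: (mc_ndR mc) => y; rewrite -(mcRC mc) mc_star_ip_eq0 ?star_0 //.
by rewrite -(mcRA mc) (mc_compat mc) h (mcR0 mc).
Qed.

(** Since s Theta_{x,y} = Theta_{s x,y} = 0, fullness gives s S = 0, in particular s s* = 0. *)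
Lemma lact_faithful s : (forall x, s ▹ x = 0) -> s = 0.
Proof.
move=> h; rewrite -[s]starK; suff -> : star s = 0 by rewrite star_0.
apply: (emb_star_mul_eq0 iSP); rewrite starK; move: (star s) => t.
apply: (lspan_ind (K := fun t => s ⋅ t = 0) (mc_fullS mc)) t => [|a b ha hb|c _ [x [y ->]]].
- exact: amul0r.
- by rewrite amulDr ha hb addr0.
- have -> : s ⋅ (c *: ipS x y) = c *: ipS (s ▹ x) y by rewrite (mcSA mc) amulZr.
  by rewrite h -(scale0r (0 : X)) (mcSZ mc) scale0r scaler0.
Qed.

(** The vector u x is characterized by s (u x) = (s u) x for all s. By [lact_nondeg] this determines
    it, so u (t x) = (u t) x may serve as a definition whatever the way in which a vector is written
    as a sum of such t x. *)
Lemma act_ex u x : exists y, forall s, s ▹ y = rmul s u ▹ x.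
Proof.
apply: (lspan_ind (K := fun x => exists y, forall s, s ▹ y = rmul s u ▹ x) (mc_spanS mc)) x.
- by exists 0 => s; rewrite !lact0r.
- by move=> x x' [y yE] [y' y'E]; exists (y + y') => s; rewrite !lactDr yE y'E.
- move=> c _ [t [x ->]]; exists (c *: (lmul u t ▹ x)) => s.
  rewrite !lactZr !lactA; congr (_ *: (_ ▹ x)).
  by apply: (emb_inj iSP); rewrite !(emb_mul iSP) unitz_lmulE unitz_rmulE mulrA.
Qed.

(* Extends the action of the ideal S to the unitization of the ambient algebra. *)
Definition act u x : X := projT1 (cid (act_ex u x)).

Lemma actE u x s : s ▹ act u x = rmul s u ▹ x.
Proof. exact: projT2 (cid (act_ex u x)) s. Qed.

Lemma lact_sep x y : (forall s, s ▹ x = s ▹ y) -> x = y.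
Proof.
move=> h; apply/eqP; rewrite -subr_eq0; apply/eqP/lact_nondeg => s.
by rewrite lactDr h -scaleN1r lactZr scaleN1r subrr.
Qed.

Lemma act_eq u x y : (forall s, s ▹ y = rmul s u ▹ x) -> act u x = y.
Proof. by move=> h; apply: lact_sep => s; rewrite actE h. Qed.

Lemma actDr u x y : act u (x + y) = act u x + act u y.
Proof. by apply: act_eq => s; rewrite !lactDr !actE. Qed.
Lemma actZr u c x : act u (c *: x) = c *: act u x.
Proof. by apply: act_eq => s; rewrite !lactZr !actE. Qed.
Lemma actDl u v x : act (u + v) x = act u x + act v x.
Proof.
apply: act_eq => s; rewrite !lactDr !actE -lactDl; congr (_ ▹ x).
by apply: (emb_inj iSP); rewrite (emb_add iSP) !unitz_rmulE mulrDr.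
Qed.
Lemma actZl c u x : act (c *: u) x = c *: act u x.
Proof.
apply: act_eq => s; rewrite !lactZr !actE -lactZl; congr (_ ▹ x).
by apply: (emb_inj iSP); rewrite (emb_scale iSP) !unitz_rmulE scalerAr.
Qed.
Lemma actM u v x : act (u * v) x = act u (act v x).
Proof.
apply: act_eq => s; rewrite !actE; congr (_ ▹ x).
by apply: (emb_inj iSP); rewrite !unitz_rmulE mulrA.
Qed.
Lemma act_emb s x : act (eS s) x = s ▹ x.
Proof.
apply: act_eq => t; rewrite lactA; congr (_ ▹ x).
by apply: (emb_inj iSP); rewrite (emb_mul iSP) unitz_rmulE.
Qed.
Lemma act1 x : act 1 x = x.
Proof.
apply: act_eq => t; congr (_ ▹ x).
by apply: (emb_inj iSP); rewrite unitz_rmulE mulr1.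
Qed.
Lemma act_ract u x r : act u (x ◃ r) = act u x ◃ r.
Proof. by apply: act_eq => t; rewrite -!lractA actE. Qed.
Lemma act0r u : act u 0 = 0.
Proof. by rewrite -(scale0r 0) actZr !scale0r. Qed.
Lemma actNl u x : act (- u) x = - act u x.
Proof. by rewrite -scaleN1r actZl scaleN1r. Qed.
Lemma act_adj u x y : ipR (act u x) y = ipR x (act (ustar u) y).
Proof.
apply: (lspan_ind (K := fun x => ipR (act u x) y = ipR x (act (ustar u) y)) (mc_spanS mc)) x.
- by rewrite act0r !(mcR0l mc).
- by move=> x x' h h'; rewrite actDr !(mcRDl mc) h h'.
- move=> c _ [s [x ->]]; rewrite actZr !(mcRZl mc); congr (_ *: _).
  rewrite -act_emb -actM -(unitz_lmulE iSP) !act_emb !(mc_adjR mc) actE.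
  congr (ipR x (_ ▹ y)); apply: (emb_inj iSP).
  by rewrite unitz_rmulE !(emb_ustar iSP) unitz_lmulE ustarM.
Qed.

Lemma ip_self_eq0 z : ipR z z = 0 -> z = 0.
Proof.
move=> h; have s0 : ipS z z = 0.
  apply: (emb_star_mul_eq0 iSP); rewrite (mcSC mc) -(mcSA mc) -(mc_compat mc) h ract0r.
  by rewrite -(scale0r (0 : X)) (mcSZ mc) scale0r.
apply: (mc_ndR mc) => y; apply: mc_star_ip_eq0.
by rewrite -(mcRA mc) (mc_compat mc) s0 lact0l (mcR0 mc).
Qed.

(** The unitization need not act faithfully on X, for instance when B is unital, so equations in it
    are first obtained modulo this ideal. By [null_emb] it meets S trivially. *)
Definition null u := forall x, act u x = 0.

Lemma null_mull u v : null v -> null (u * v).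
Proof. by move=> h x; rewrite actM h act0r. Qed.
Lemma null_mulr u v : null u -> null (u * v).
Proof. by move=> h x; rewrite actM h. Qed.
Lemma nullZ c u : null u -> null (c *: u).
Proof. by move=> h x; rewrite actZl h scaler0. Qed.
Lemma null_star_mul u : null (ustar u * u) -> null u.
Proof.
by move=> h x; apply: ip_self_eq0; rewrite act_adj -actM h (mcR0 mc).
Qed.
Lemma null_ustar u : null u -> null (ustar u).
Proof.
move=> h x; apply: (mc_ndR mc) => y.
by rewrite act_adj ustarK h (mcR0 mc).
Qed.
Lemma null_emb s : null (eS s) -> s = 0.
Proof. by move=> h; apply: lact_faithful => x; rewrite -act_emb. Qed.

Definition ip_abs y (j q : UB) := abs_data (eS (ipS y y)) j q.

Lemma ip_abs_ex y : exists jq : UB * UB, ip_abs y jq.1 jq.2.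
Proof. by apply: abs_data_ex; rewrite -(emb_ustar iSP) (mcSC mc). Qed.

Local Notation part b y j := (sgn_part b (eS (ipS y y)) j).

Lemma emb_sgn b s : eS (sgn b s) = sgn b (eS s).
Proof. by case: b; rewrite ?(emb_opp iSP). Qed.

Lemma null_sq u : ustar u = u -> null (u * u) -> null u.
Proof. by move=> uu h; apply: null_star_mul; rewrite uu. Qed.

Lemma sgn_ip_part b y j q x : ip_abs y j q ->
  emb_positive iR (sgn b (ipR (act (q * part b y j) x) (act (q * part b y j) x))).
Proof.
move=> d; set P := part b y j; have PP := sgn_part_herm b d.
(* With p = Theta_{y,y}, one has q P q P = P |p| P, and |p| P is p P up to the sign b. *)
have -> : ipR (act (q * P) x) (act (q * P) x) = sgn b (ipR (act P x) (ipS y y ▹ act P x)).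
  rewrite act_adj ustarM PP (positive_herm (abs_rootpos d)) -[P * q](sgn_part_root b d) -actM.
  rewrite act_adj PP -act_emb -!actM.
  have -> : q * P * (q * P) = P * (j * P).
    by rewrite {1}(sgn_part_root b d) -mulrA (mulrA q q) (abs_root d).
  have -> : j * P = sgn b (eS (ipS y y) * P).
    by rewrite (sgn_part_mul b d) sgnK.
  have actsgn u z : act (sgn b u) z = sgn b (act u z) by case: (b); rewrite //= actNl.
  have ipsgn z w : ipR z (sgn b w) = sgn b (ipR z w) by case: (b); rewrite //= (mcRN mc).
  by rewrite sgnMr actsgn ipsgn !mulrA.
rewrite sgnK -(mc_compat mc) (mcRA mc) -(mcRC mc); exact: emb_positive_star_mul.
Qed.

Lemma null_part_root b y j q u : ip_abs y j q ->
  null (u * (q * part b y j)) -> null (u * part b y j).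
Proof.
move=> d h; set P := part b y j; have PP := sgn_part_herm b d.
have n2 : null (u * P * P).
  rewrite -mulrA (sgn_part_sq b d) -/P -scalerAr -(abs_root d); apply: nullZ.
  by rewrite -[q * q * _]mulrA (sgn_part_root b d) -/P !mulrA -(mulrA u); apply: null_mulr.
have n3 : null (ustar (u * P)).
  apply: null_star_mul; rewrite ustarK ustarM PP mulrA; exact: null_mulr.
by rewrite -[u * P]ustarK; apply: null_ustar.
Qed.

(* Let M and N be q P for the opposite parts of y and y', and m = M c N.  The
   vectors m* m w and m |m| w have the same inner square; the first one lies in
   the range of N and the second one in the range of M, so this inner square is
   both positive and negative, and m* m w = 0. *)
Lemma null_parts b y j q y' j' q' c : ip_abs y j q -> ip_abs y' j' q' ->
  null (part b y j * c * part (~~ b) y' j').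
Proof.
move=> d d'; set P := part b y j; set P' := part (~~ b) y' j'.
have PP : ustar P = P := sgn_part_herm b d.
have PP' : ustar P' = P' := sgn_part_herm (~~ b) d'.
have MM : ustar (q * P) = q * P.
  by rewrite ustarM PP (positive_herm (abs_rootpos d)) -(sgn_part_root b d).
have NN : ustar (q' * P') = q' * P'.
  by rewrite ustarM PP' (positive_herm (abs_rootpos d')) -(sgn_part_root (~~ b) d').
have null_roots a : null (q * P * a * (q' * P')).
  set m := _ * a * _; apply: null_star_mul => w.
  have [k [kp k2 _]] := positive_sqrt (positive_star_mul m).
  have kk := positive_herm kp; apply: ip_self_eq0.
  have e1 : act (ustar m * m) w = act (q' * P') (act (ustar a * (q * P) * m) w).
    by rewrite -actM {1}/m ustarM NN [ustar (_ * a)]ustarM MM !mulrA.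
  have e2 : ipR (act (ustar m * m) w) (act (ustar m * m) w) =
      ipR (act (q * P) (act (a * (q' * P') * k) w)) (act (q * P) (act (a * (q' * P') * k) w)).
    rewrite -!actM (_ : q * P * _ = m * k); last by rewrite /m !mulrA.
    rewrite !act_adj -!actM; congr (ipR _ (act _ _)); clearbody m.
    have kmk : k * ustar m * (m * k) = k * (k * k) * k by rewrite k2 !mulrA.
    by rewrite !ustarM ustarK kk kmk -k2 !mulrA.
  have := sgn_ip_part b (act (a * (q' * P') * k) w) d; rewrite -/P -e2.
  have := sgn_ip_part (~~ b) (act (ustar a * (q * P) * m) w) d'; rewrite -/P' -e1.
  by case: (b) => /= h1 h2; apply: (emb_positive_anti iRP).
(* The root q' is cancelled on the right; passing to adjoints brings q to the right, where it is
   cancelled in the same way. *)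
have null_right a : null (q * P * a * P') by apply: null_part_root d' _.
have : null (P' * ustar c * P).
  apply: null_part_root d _; have := null_ustar (null_right c).
  by rewrite !ustarM PP' -ustarM MM mulrA.
by move=> /null_ustar; rewrite !ustarM PP PP' ustarK mulrA.
Qed.

(* The submodule on which ipR and ipS are positive (b = true) or negative
   (b = false); X is the direct sum of the two. *)
Definition sgn_sub b x := forall y j q, ip_abs y j q ->
  forall c, act (part (~~ b) y j * c) x = 0.

Lemma sgn_subD b x x' : sgn_sub b x -> sgn_sub b x' -> sgn_sub b (x + x').
Proof. by move=> h h' y j q d c; rewrite actDr (h _ _ _ d) (h' _ _ _ d) addr0. Qed.
Lemma sgn_subZ b a x : sgn_sub b x -> sgn_sub b (a *: x).
Proof. by move=> h y j q d c; rewrite actZr (h _ _ _ d) scaler0. Qed.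
Lemma sgn_subN b x : sgn_sub b x -> sgn_sub b (- x).
Proof. by rewrite -scaleN1r; exact: sgn_subZ. Qed.
Lemma sgn_sub0 b : sgn_sub b 0.
Proof. by move=> y j q _ c; rewrite act0r. Qed.
Lemma sgn_sub_act b u x : sgn_sub b x -> sgn_sub b (act u x).
Proof. by move=> h y j q d c; rewrite -actM -mulrA (h _ _ _ d). Qed.
Lemma sgn_sub_lact b s x : sgn_sub b x -> sgn_sub b (s ▹ x).
Proof. by rewrite -act_emb; exact: sgn_sub_act. Qed.
Lemma sgn_sub_ract b r x : sgn_sub b x -> sgn_sub b (x ◃ r).
Proof. by move=> h y j q d c; rewrite act_ract (h _ _ _ d) ract0l. Qed.

Lemma sgn_sub_part b y j q x : ip_abs y j q -> sgn_sub b (act (part b y j) x).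
Proof.
move=> d y' j' q' d' c; rewrite -actM; have := null_parts (~~ b) c d' d.
by rewrite negbK; exact.
Qed.

(** Both parts of each Theta_{y,y} kill x, hence so does Theta_{y,y}, and <x,y><y,x> = <x,
    Theta_{y,y} x> = 0. *)
Lemma sgn_sub_disjoint x : sgn_sub true x -> sgn_sub false x -> x = 0.
Proof.
move=> h h'; apply: (mc_ndR mc) => y; rewrite -(mcRC mc) mc_star_ip_eq0 ?star_0 //.
rewrite -(mcRA mc) (mc_compat mc) -act_emb; have [[j q] d] := ip_abs_ex y.
have := sgn_part_sub true (eS (ipS y y)) j => /= e.
have -> : eS (ipS y y) = 2^-1 *: (part true y j * 1 - part false y j * 1).
  by rewrite !mulr1 e scalerA mulVf ?scale1r // pnatr_eq0.
by rewrite actZl actDl actNl (h _ _ _ d) (h' _ _ _ d) subr0 scaler0 (mcR0 mc).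
Qed.

Lemma ipS_ind (K : S -> Prop) : K 0 -> (forall s t, K s -> K t -> K (s + t)) ->
  (forall (c : T[i]) s, K s -> K (c *: s)) -> (forall y, K (ipS y y)) -> forall s, K s.
Proof.
move=> K0 KD KZ Kip; apply: (lspan_ind (mc_fullS mc)) => // c _ [x [y ->]].
apply: (KZ); apply: (polarization_ind (D := setT) (f := ipS) (c := - 'i)) => //.
- exact: (mcSDr mc).
- exact: (mcSD mc).
- by move=> a a'; rewrite (mcSZr mc) conjCi.
- by move=> a a'; rewrite (mcSZ mc) opprK.
- by rewrite oppr_eq0 neq0Ci.
Qed.

(** By linearity and polarization only vectors Theta_{y,y} x have to be split, and Theta_{y,y} is
    half the difference of its two [sgn_part]s. *)
Lemma sgn_sub_decomp x : exists x1, sgn_sub true x1 /\ sgn_sub false (x - x1).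
Proof.
apply: (lspan_ind (K := fun x => exists x1, sgn_sub true x1 /\ sgn_sub false (x - x1))
  (mc_spanS mc)) x.
- by exists 0; rewrite subrr; split; exact: sgn_sub0.
- move=> x x' [x1 [h1 h2]] [x1' [h1' h2']]; exists (x1 + x1').
  by rewrite opprD addrACA; split; exact: sgn_subD.
move=> c _ [s [x ->]]; suff [x1 [h1 h2]] : exists x1, sgn_sub true x1 /\ sgn_sub false (s ▹ x - x1).
  by exists (c *: x1); rewrite -scalerBr; split; exact: sgn_subZ.
apply: (ipS_ind (K := fun s => exists x1, sgn_sub true x1 /\ sgn_sub false (s ▹ x - x1))) s.
- by exists 0; rewrite lact0l subrr; split; exact: sgn_sub0.
- move=> s t [x1 [h1 h2]] [x1' [h1' h2']]; exists (x1 + x1').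
  by rewrite lactDl opprD addrACA; split; exact: sgn_subD.
- move=> a s [x1 [h1 h2]]; exists (a *: x1).
  by rewrite lactZl -scalerBr; split; exact: sgn_subZ.
move=> y; have [[j q] d] := ip_abs_ex y; exists (2^-1 *: act (part true y j) x); split.
  by apply: sgn_subZ; exact: (sgn_sub_part _ _ d).
have -> : ipS y y ▹ x - 2^-1 *: act (part true y j) x = - (2^-1 *: act (part false y j) x).
  rewrite -[part true y j](subrK (part false y j)) (sgn_part_sub true) /= actDl actZl.
  by rewrite act_emb scalerDr scalerA mulVf ?pnatr_eq0 // scale1r opprD addrA subrr add0r.
by apply: sgn_subN; apply: sgn_subZ; exact: (sgn_sub_part _ _ d).
Qed.

(** Passes from null to zero. With p = Theta_{y,y} and P its opposite part, p P lies in S and acts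
    as 0, so p P = 0. Then |p| P = 0 and P^2 = 0, whence P = 0. *)
Lemma null_part_positive b y j q : ip_abs y j q -> null (part (~~ b) y j) ->
  emb_positive iS (sgn b (ipS y y)).
Proof.
move=> d n; have PP := sgn_part_herm (~~ b) d.
have pP : eS (ipS y y) * part (~~ b) y j = 0.
  rewrite -(unitz_rmulE iSP); have -> : rmul (ipS y y) (part (~~ b) y j) = 0.
    by apply: null_emb; rewrite unitz_rmulE; exact: null_mull.
  exact: (emb0 iSP).
have jP : j * part (~~ b) y j = 0.
  by rewrite -[LHS](sgnK (~~ b)) -(sgn_part_mul (~~ b) d) pP; case: (~~ b); rewrite /= ?oppr0.
rewrite /emb_positive emb_sgn (sgn_part_opp_eq0 (b := b) (j := j)); first exact: abs_pos d.
by apply: sq_eq0 => //; rewrite (sgn_part_sq _ d) jP scaler0.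
Qed.

(** Let P be the opposite part of p = Theta_{y,y}. Up to sign P^2 x is 2 p P x = 2 y <y, P x>, which
    lies in the submodule of y; being in the range of P it also lies in the other one, so it is
    0. *)
Lemma sgn_sub_positive b y : sgn_sub b y -> emb_positive iS (sgn b (ipS y y)).
Proof.
move=> yb; have [[j q] d] := ip_abs_ex y; apply: (null_part_positive d).
apply: null_sq => [|x]; first exact: sgn_part_herm d.
set P := part (~~ b) y j; set z := act P x.
have zn : sgn_sub (~~ b) (act P z) by exact: (sgn_sub_part _ _ d).
have zp : sgn_sub b (act (P * P) x).
  rewrite (sgn_part_sq _ d) -[j * _](sgnK (~~ b)) -(sgn_part_mul _ d) actZl.
  apply: sgn_subZ; case: (~~ b); rewrite /= ?actNl actM act_emb -(mc_compat mc).
    exact: sgn_sub_ract.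
  by apply: sgn_subN; exact: sgn_sub_ract.
rewrite /z -actM in zn; case: (b) zp zn => /= h1 h2; exact: sgn_sub_disjoint.
Qed.

(** If P is the negative part of Theta_{y,y}, the inner square of q P x is negative by [sgn_ip_part]
    and positive by hypothesis, so q P is null. Applied to the conjugate bimodule, this carries
    positivity from S to R. *)
Lemma positive_ipS : (forall x, emb_positive iR (ipR x x)) ->
  forall y, emb_positive iS (ipS y y).
Proof.
move=> pos y; have [[j q] d] := ip_abs_ex y.
apply: (null_part_positive (b := true) d); rewrite -[part _ _ _]mul1r.
apply: (null_part_root d) => x; rewrite mul1r; apply: ip_self_eq0.
by apply: (emb_positive_anti iRP) => //; have := sgn_ip_part false x d.
Qed.

Definition pos_part x : X := projT1 (cid (sgn_sub_decomp x)).
(* The symmetry of X with eigenvalues 1 and -1 on these submodules: composing the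
   inner products with it makes them positive. *)
Definition signature x : X := pos_part x - (x - pos_part x).

Lemma sgn_sub_sum x : exists x1 x2, [/\ sgn_sub true x1, sgn_sub false x2 & x = x1 + x2].
Proof.
have [x1 [h1 h2]] := sgn_sub_decomp x; exists x1, (x - x1); split=> //.
by rewrite addrC subrK.
Qed.

Lemma signatureE x1 x2 : sgn_sub true x1 -> sgn_sub false x2 ->
  signature (x1 + x2) = x1 - x2.
Proof.
move=> h1 h2; rewrite /signature /pos_part; case: (cid _) => /= c [c1 c2].
have -> : c = x1.
  apply/eqP; rewrite -subr_eq0; apply/eqP/sgn_sub_disjoint.
    by apply: sgn_subD => //; exact: sgn_subN.
  have -> : c - x1 = x2 - (x1 + x2 - c) by rewrite opprB addrCA opprD [- x1 - x2]addrC addNKr.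
  by apply: sgn_subD => //; exact: sgn_subN.
by rewrite addrAC subrr add0r.
Qed.

Lemma signatureD x y : signature (x + y) = signature x + signature y.
Proof.
have [x1 [x2 [h1 h2 ->]]] := sgn_sub_sum x; have [y1 [y2 [k1 k2 ->]]] := sgn_sub_sum y.
by rewrite addrACA !signatureE //; [rewrite opprD addrACA|exact: sgn_subD..].
Qed.
Lemma signatureZ c x : signature (c *: x) = c *: signature x.
Proof.
have [x1 [x2 [h1 h2 ->]]] := sgn_sub_sum x.
by rewrite scalerDr !signatureE // ?scalerBr //; exact: sgn_subZ.
Qed.
Lemma signature_ract x r : signature (x ◃ r) = signature x ◃ r.
Proof.
have [x1 [x2 [h1 h2 ->]]] := sgn_sub_sum x.
rewrite ractDl !signatureE // ?ractDl; [|exact: sgn_sub_ract..].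
by rewrite -(scaleN1r x2) ractZl scaleN1r.
Qed.
Lemma signature_lact s x : signature (s ▹ x) = s ▹ signature x.
Proof.
have [x1 [x2 [h1 h2 ->]]] := sgn_sub_sum x.
rewrite lactDr !signatureE // ?lactDr; [|exact: sgn_sub_lact..].
by rewrite -(scaleN1r x2) lactZr scaleN1r.
Qed.
Lemma signatureK : involutive signature.
Proof.
move=> x; have [x1 [x2 [h1 h2 ->]]] := sgn_sub_sum x.
by rewrite signatureE // signatureE ?opprK //; exact: sgn_subN.
Qed.

(** The vector Theta_{x,x} y = x <x,y> lies in both submodules, so <y,x><x,y> = 0. *)
Lemma sgn_sub_ipR x y : sgn_sub true x -> sgn_sub false y -> ipR x y = 0.
Proof.
move=> h k; apply: mc_star_ip_eq0; rewrite -(mcRA mc) (mc_compat mc).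
have -> : ipS x x ▹ y = 0; last by rewrite (mcR0 mc).
apply: sgn_sub_disjoint; last exact: sgn_sub_lact.
by rewrite -(mc_compat mc); exact: sgn_sub_ract.
Qed.

Lemma sgn_sub_ipS x y : sgn_sub true x -> sgn_sub false y -> ipS x y = 0.
Proof.
move=> h k; rewrite -[ipS x y]starK; suff -> : star (ipS x y) = 0 by exact: star_0.
apply: (emb_star_mul_eq0 iSP); rewrite starK; apply: lact_faithful => z.
rewrite -lactA; apply: sgn_sub_disjoint.
  by rewrite -(mc_compat mc); exact: sgn_sub_ract.
by apply: sgn_sub_lact; rewrite (mcSC mc) -(mc_compat mc); exact: sgn_sub_ract.
Qed.

Lemma signature_ipR x y : ipR (signature x) y = ipR x (signature y).
Proof.
have [x1 [x2 [h1 h2 ->]]] := sgn_sub_sum x; have [y1 [y2 [k1 k2 ->]]] := sgn_sub_sum y.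
rewrite !signatureE // !(mcRDl mc) !(mcRD mc) !(mcRNl mc) !(mcRN mc).
have -> : ipR x2 y1 = 0 by rewrite -(mcRC mc) (sgn_sub_ipR k1 h2) star_0.
by rewrite (sgn_sub_ipR h1 k2) !(addr0, add0r, oppr0, subr0).
Qed.

Lemma signature_ipS x y : ipS (signature x) y = ipS x (signature y).
Proof.
have [x1 [x2 [h1 h2 ->]]] := sgn_sub_sum x; have [y1 [y2 [k1 k2 ->]]] := sgn_sub_sum y.
rewrite !signatureE // !(mcSD mc) !(mcSDr mc) !(mcSN mc) !(mcSNr mc).
have -> : ipS x2 y1 = 0 by rewrite -(mcSC mc) (sgn_sub_ipS k1 h2) star_0.
by rewrite (sgn_sub_ipS h1 k2) !(addr0, add0r, oppr0, subr0).
Qed.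

Lemma signature_positive y : emb_positive iS (ipS y (signature y)).
Proof.
have [y1 [y2 [h1 h2 ->]]] := sgn_sub_sum y.
rewrite signatureE // !(mcSD mc) !(mcSDr mc) !(mcSNr mc).
have -> : ipS y2 y1 = 0 by rewrite -(mcSC mc) (sgn_sub_ipS h1 h2) star_0.
rewrite (sgn_sub_ipS h1 h2) oppr0 addr0 add0r /emb_positive (emb_add iSP).
by apply: positiveD; [exact: (sgn_sub_positive h1)|exact: (sgn_sub_positive h2)].
Qed.

(** The signature is an involution commuting with both actions and self-adjoint for both inner
    products, so every axiom is inherited. *)
Lemma Morita_context_signature :
  Morita_context (fun x y => ipR x (signature y)) (fun x y => ipS x (signature y)).
Proof.
split.
- split=> [x y z|c x y|x y r|x y].
  + by rewrite signatureD (mcRD mc).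
  + by rewrite signatureZ (mcRZ mc).
  + by rewrite signature_ract (mcRA mc).
  + by rewrite (mcRC mc) signature_ipR.
- split=> [x y z|c x y|s x y|x y].
  + by rewrite (mcSD mc).
  + by rewrite (mcSZ mc).
  + by rewrite (mcSA mc).
  + by rewrite (mcSC mc) signature_ipS.
- have := mc_fullR mc; rewrite /ip_full => <-; congr lspan; apply/seteqP.
  split=> [_ [x [y ->]]|_ [x [y ->]]]; first by exists x, (signature y).
  by exists x, (signature y); rewrite signatureK.
- have := mc_fullS mc; rewrite /ip_full => <-; congr lspan; apply/seteqP.
  split=> [_ [x [y ->]]|_ [x [y ->]]]; first by exists x, (signature y).
  by exists x, (signature y); rewrite signatureK.
- by move=> s x y; rewrite (mc_adjR mc) signature_lact.
- by move=> r x y; rewrite (mc_adjS mc) signature_ract.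
- by move=> x y z; rewrite -signature_ipR (mc_compat mc).
- by move=> x h; apply: (mc_ndR mc) => y; rewrite -[y]signatureK.
- by move=> x h; apply: (mc_ndS mc) => y; rewrite -[y]signatureK.
- exact: mc_spanR mc.
- exact: mc_spanS mc.
Qed.

End ContextAction.

Lemma Morita_context_positive (T : realType) (A B : cstarAlgType T)
    (R S : starAlgType T[i]) (iR : R -> A) (iS : S -> B) (X : bimodType S R)
    (ipR : X -> X -> R) (ipS : X -> X -> S) :
  ideal_embedding iR -> ideal_embedding iS -> Morita_context ipR ipS ->
  exists (ipR' : X -> X -> R) (ipS' : X -> X -> S), [/\ Morita_context ipR' ipS',
    forall x, emb_positive iR (ipR' x x) & forall x, emb_positive iS (ipS' x x)].
Proof.
move=> iRP iSP mc; have mc' := Morita_context_signature iRP iSP mc.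
have pS := signature_positive iRP iSP mc.
eexists; eexists; split; [exact: mc'| |exact: pS].
exact: (positive_ipS iSP iRP (Morita_context_conj mc') pS).
Qed.

(** * Complete positivity *)

Lemma ge0_of_approx (T : realType) (z : T[i]) :
  (forall e : T, 0 < e -> exists u v, [/\ z = u + v, 0 <= u & `|v| <= e%:C%C]) -> 0 <= z.
Proof.
move=> h; rewrite lecE /=; apply/andP; split.
  rewrite -normr_le0; apply/ler_addgt0Pr => e e0; have [u [v [-> u0 ve]]] := h e e0.
  rewrite raddfD /= (ger0_Im u0) add0r add0r -lecR (le_trans _ ve) //.
  exact: normc_ge_Im.
rewrite -oppr_le0; apply/ler_addgt0Pr => e e0; have [u [v [-> u0 ve]]] := h e e0.
have re : `|complex.Re v| <= e by rewrite -lecR (le_trans _ ve) ?normc_ge_Re.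
have : 0 <= complex.Re u by move: u0; rewrite lecE => /andP[].
by rewrite raddfD /=; move: re; rewrite ler_norml => /andP[]; lra.
Qed.

(* A semidefinite sesquilinear form with a representation of R by adjointable
   maps: either a pre-Hilbert space, or R itself with <r, s> = w (r* s). *)
Record semi_representation (C : numClosedFieldType) (R : starAlgType C)
    (H : lmodType C) (h : H -> H -> C) (pi : R -> H -> H) : Prop := {
  sr_hD : forall a b c, h a (b + c) = h a b + h a c;
  sr_hZ : forall (z : C) a b, h a (z *: b) = z * h a b;
  sr_hDl : forall a b c, h (a + b) c = h a c + h b c;
  sr_hZl : forall (z : C) a b, h (z *: a) b = z^* * h a b;
  sr_h_ge0 : forall a, 0 <= h a a;
  sr_D : forall r a b, pi r (a + b) = pi r a + pi r b;
  sr_Z : forall r (z : C) a, pi r (z *: a) = z *: pi r a;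
  sr_Dl : forall r s a, pi (r + s) a = pi r a + pi s a;
  sr_Zl : forall (z : C) r a, pi (z *: r) a = z *: pi r a;
  sr_M : forall r s a, pi (r ⋅ s) a = pi r (pi s a);
  sr_adj : forall r a b, h (pi r a) b = h a (pi (star r) b)
}.

Section FormOfLists.
Variables (C : numClosedFieldType) (R : starAlgType C) (H : lmodType C).
Variables (h : H -> H -> C) (pi : R -> H -> H).
Hypothesis sr : semi_representation h pi.
Variables (X : rightModType R) (ip : X -> X -> R).
Hypothesis ipP : right_inner_product ip.

Definition list_form (s t : seq (X * H)) : C :=
  \sum_(p <- s) \sum_(q <- t) h p.2 (pi (ip p.1 q.1) q.2).

Lemma sr_h0 a : h a 0 = 0. Proof. by rewrite -(scale0r (0 : H)) (sr_hZ sr) mul0r. Qed.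
Lemma sr_h0l a : h 0 a = 0.
Proof. by rewrite -(scale0r (0 : H)) (sr_hZl sr) conjC0 mul0r. Qed.
Lemma sr_0l a : pi 0 a = 0. Proof. by rewrite -(scale0r (0 : R)) (sr_Zl sr) scale0r. Qed.
Lemma sr_0 r : pi r 0 = 0. Proof. by rewrite -(scale0r (0 : H)) (sr_Z sr) !scale0r. Qed.
Lemma sr_hsum I (r : seq I) (F : I -> H) a : h a (\sum_(k <- r) F k) = \sum_(k <- r) h a (F k).
Proof. by elim/big_rec2: _ => [|k y x _ <-]; rewrite ?sr_h0 // (sr_hD sr). Qed.
Lemma sr_hsuml I (r : seq I) (F : I -> H) a : h (\sum_(k <- r) F k) a = \sum_(k <- r) h (F k) a.
Proof. by elim/big_rec2: _ => [|k y x _ <-]; rewrite ?sr_h0l // (sr_hDl sr). Qed.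
Lemma sr_sum I (r : seq I) (F : I -> H) a : pi a (\sum_(k <- r) F k) = \sum_(k <- r) pi a (F k).
Proof. by elim/big_rec2: _ => [|k y x _ <-]; rewrite ?sr_0 // (sr_D sr). Qed.

Lemma list_form_relr s t t' : tensor_rel pi t t' -> list_form s t = list_form s t'.
Proof.
move=> e; rewrite /list_form; apply: eq_bigr => -[x psi] _ /=.
elim: e => {t t'} //=.
- by move=> r t u _ -> _ ->.
- by move=> r r' t t' _ h1 _ h2; rewrite !big_cat /= h1 h2.
- by move=> r t; rewrite !big_cat /= addrC.
- move=> phi; rewrite big_seq1 big_nil /= -(scale0r (0 : X)) (ripZ ipP).
  by rewrite (sr_Zl sr) scale0r sr_h0.
- move=> y z phi; rewrite !big_cons big_nil /= !addr0 (ripD ipP) (sr_Dl sr).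
  by rewrite (sr_hD sr).
- by move=> y phi phi'; rewrite !big_cons big_nil /= !addr0 (sr_D sr) (sr_hD sr).
- by move=> c y phi; rewrite !big_seq1 /= (ripZ ipP) (sr_Zl sr) (sr_Z sr).
- by move=> y r phi; rewrite !big_seq1 /= (ripA ipP) (sr_M sr).
Qed.

Lemma list_form_rell s s' t : tensor_rel pi s s' -> list_form s t = list_form s' t.
Proof.
move=> e; rewrite /list_form exchange_big [RHS]exchange_big; apply: eq_bigr => -[x psi] _ /=.
elim: e => {s s'} //=.
- by move=> r s u _ -> _ ->.
- by move=> r r' s s' _ h1 _ h2; rewrite !big_cat /= h1 h2.
- by move=> r s; rewrite !big_cat /= addrC.
- move=> phi; rewrite big_seq1 big_nil /= (ripC ipP) -(scale0r (0 : X)) (ripZ ipP).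
  by rewrite scale0r star_0 sr_0l sr_h0.
- move=> y z phi; rewrite !big_cons big_nil /= !addr0 (ripC ipP) (ripD ipP) starD.
  by rewrite -!(ripC ipP) (sr_Dl sr) (sr_hD sr).
- by move=> y phi phi'; rewrite !big_cons big_nil /= !addr0 (sr_hDl sr).
- move=> c y phi; rewrite !big_seq1 /= (ripC ipP) (ripZ ipP) starZ -(ripC ipP).
  by rewrite (sr_Zl sr) (sr_hZ sr) (sr_hZl sr).
- move=> y r phi; rewrite !big_seq1 /= (ripC ipP) (ripA ipP) starM -(ripC ipP).
  by rewrite (sr_M sr) (sr_adj sr).
Qed.

End FormOfLists.

Section Positivity.
Variables (T : realType) (A B : cstarAlgType T) (R S : starAlgType T[i]).
Variables (iR : R -> A) (iS : S -> B).
Hypotheses (iRP : ideal_embedding iR) (iSP : ideal_embedding iS).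
Variables (X : bimodType S R) (ipR : X -> X -> R) (ipS : X -> X -> S).
Hypothesis mc : Morita_context ipR ipS.
Hypothesis ipR_pos : forall x, emb_positive iR (ipR x x).
Hypothesis ipS_pos : forall x, emb_positive iS (ipS x x).
Variables (H : lmodType T[i]) (h : H -> H -> T[i]) (pi : R -> H -> H).
Hypothesis sr : semi_representation h pi.
Local Notation UB := (unitization B).
Local Notation eS := (emb iS).
Local Notation act := (act iSP mc).

Local Notation datum := (S * S * X * X * R * H)%type.
(* The simple tensor (Theta_{s v, t v} (w r)) (x) psi = (s p t* (w r)) (x) psi with
   p = ipS v v >= 0, its R-valued factor being moved to the right. *)
Definition datum_tensor (p : datum) : X * H :=
  let: (s, t, v, w, r, psi) := p in (s ▹ v, pi (ipR (t ▹ v) (w ◃ r)) psi).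

(** The spanning conditions give x = Theta_{s a, t b} (w r) up to linear combinations, and
    polarization reduces to a = b = v. *)
Lemma tensor_rel_datum (s : seq (X * H)) :
  exists t : seq datum, tensor_rel pi s (map datum_tensor t).
Proof.
suff K x psi : exists t, tensor_rel pi [:: (x, psi)] (map datum_tensor t).
  elim: s => [|[x psi] s [t ht]]; first by exists [::]; exact: TensRefl.
  have [t' ht'] := K x psi; exists (t' ++ t); rewrite map_cat -cat1s.
  exact: TensCat.
pose K x := forall psi, exists t, tensor_rel pi [:: (x, psi)] (map datum_tensor t).
suff : K x by exact.
have K0 : K 0 by move=> phi; exists [::]; exact: Tens0.
have KD y z : K y -> K z -> K (y + z).
  move=> hy hz phi; have [t ht] := hy phi; have [t' ht'] := hz phi.
  exists (t ++ t'); apply: TensTrans (TensDl _ _ _ _) _; rewrite map_cat.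
  exact: (TensCat ht ht').
have KZ c y : K y -> K (c *: y).
  move=> hy phi; have [t ht] := hy (c *: phi); exists t.
  exact: TensTrans (TensZ _ _ _ _) ht.
move: x; apply: (lspan_ind (mc_spanS mc)) => // c _ [s0 [y ->]]; apply: (KZ).
apply: (lspan_ind (K := fun s => K (s ▹ y)) (mc_fullS mc)) s0.
- by rewrite lact0l.
- by move=> u u' ? ?; rewrite lactDl; exact: KD.
move=> {}c _ [a [b ->]]; rewrite lactZl; apply: (KZ).
apply: (lspan_ind (K := fun a => K (ipS a b ▹ y)) (mc_spanS mc)) a.
- by rewrite -(scale0r (0 : X)) (mcSZ mc) scale0r lact0l.
- by move=> a a' ? ?; rewrite (mcSD mc) lactDl; exact: KD.
move=> {}c _ [s1 [{}a ->]]; rewrite (mcSZ mc) lactZl; apply: (KZ).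
apply: (lspan_ind (K := fun b => K (ipS (s1 ▹ a) b ▹ y)) (mc_spanS mc)) b.
- by rewrite -(scale0r (0 : X)) (mcSZr mc) conjC0 scale0r lact0l.
- by move=> b b' ? ?; rewrite (mcSDr mc) lactDl; exact: KD.
move=> {}c _ [t [{}b ->]]; rewrite (mcSZr mc) lactZl; apply: (KZ).
rewrite (mcSAr mc) (mcSA mc).
apply: (lspan_ind (K := fun y => K (s1 ⋅ ipS a b ⋅ star t ▹ y)) (mc_spanR mc)) y.
- by rewrite lact0r.
- by move=> u u' ? ?; rewrite lactDr; exact: KD.
move=> {}c _ [w [r ->]]; rewrite lactZr; apply: (KZ).
apply: (polarization_ind (D := setT) (f := fun a b => s1 ⋅ ipS a b ⋅ star t) (c := - 'i)
   (K := fun s => K (s ▹ (w ◃ r)))) => //.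
- by move=> u u' ? ?; rewrite lactDl; exact: KD.
- by move=> z u ?; rewrite lactZl; exact: KZ.
- by move=> u u' u''; rewrite (mcSDr mc) amulDr amulDl.
- by move=> u u' u''; rewrite (mcSD mc) amulDr amulDl.
- by move=> u u'; rewrite (mcSZr mc) conjCi amulZr amulZl.
- by move=> u u'; rewrite (mcSZ mc) opprK amulZr amulZl.
- by rewrite oppr_eq0 neq0Ci.
move=> v _ phi; exists [:: (s1, t, v, w, r, phi)] => /=.
rewrite -!lactA -(mc_compat mc) -(mc_adjR mc) -lractA.
exact: TensR.
Qed.

Definition span_pi : set H :=
  [set eta | exists t : seq (R * H), eta = \sum_(p <- t) pi p.1 p.2].

Lemma span_pi_gen r psi : span_pi (pi r psi).
Proof. by exists [:: (r, psi)]; rewrite big_seq1. Qed.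

Lemma span_piD eta eta' : span_pi eta -> span_pi eta' -> span_pi (eta + eta').
Proof. by move=> [t ->] [t' ->]; exists (t ++ t'); rewrite big_cat. Qed.

Lemma span_piZ (z : T[i]) eta : span_pi eta -> span_pi (z *: eta).
Proof.
move=> [t ->]; exists [seq (p.1, z *: p.2) | p <- t].
by rewrite big_map scaler_sumr; apply: eq_bigr => p _ /=; rewrite (sr_Z sr).
Qed.

(** The square root d of <x,x> lies in the unitization of A, not in R, and need not act on H. Since
    d R lies in R it can be applied to vectors in the span of pi(R) H, and the form becomes the
    inner square of d eta. *)
Lemma sr_ip_ge0 eta x : span_pi eta -> 0 <= h eta (pi (ipR x x) eta).
Proof.
move=> [t ->]; have [d [dp d2 _]] := positive_sqrt (ipR_pos x).
pose eta' := \sum_(p <- t) pi (unitz_lmul iRP d p.1) p.2.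
suff -> : h (\sum_(p <- t) pi p.1 p.2) (pi (ipR x x) (\sum_(p <- t) pi p.1 p.2)) =
    h eta' eta' by exact: sr_h_ge0 sr _.
rewrite (sr_sum sr) !(sr_hsuml sr); apply: eq_bigr => p _.
rewrite !(sr_hsum sr); apply: eq_bigr => q _.
rewrite !(sr_adj sr) -!(sr_M sr); congr (h _ (pi _ _)); apply: (emb_inj iRP).
rewrite !(emb_mul iRP) (emb_ustar iRP) -d2 [in RHS](emb_ustar iRP) !unitz_lmulE ustarM.
by rewrite (positive_herm dp) !mulrA.
Qed.

Definition bounded_functional (g : UB -> T[i]^o) : Prop :=
  exists2 C : T[i], 0 <= C & forall b (M : T), norm_le b M -> `|g b| <= C * M%:C%C.

Lemma bounded_functionalD g g' :
  bounded_functional g -> bounded_functional g' -> bounded_functional (g + g').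
Proof.
move=> [C C0 hC] [C' C'0 hC']; exists (C + C'); first exact: addr_ge0.
move=> b M bM; rewrite mulrDl (le_trans (ler_normD _ _)) //.
by rewrite lerD //; [exact: hC|exact: hC'].
Qed.

Lemma bounded_functionalZ (z : T[i]) g :
  bounded_functional g -> bounded_functional (z *: g).
Proof.
move=> [C C0 hC]; exists (`|z| * C); first exact: mulr_ge0.
by move=> b M bM; rewrite normrM -mulrA ler_wpM2l //; exact: hC.
Qed.

Definition matrix_coef eta x eta' x' : UB -> T[i]^o :=
  fun b => h eta (pi (ipR x (act b x')) eta').

Lemma matrix_coefD eta x eta' x' b c : matrix_coef eta x eta' x' (b + c) =
  matrix_coef eta x eta' x' b + matrix_coef eta x eta' x' c.
Proof. by rewrite /matrix_coef (actDl iRP) (mcRD mc) (sr_Dl sr) (sr_hD sr). Qed.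

Lemma matrix_coefZ eta x eta' x' (z : T[i]) b : matrix_coef eta x eta' x' (z *: b) =
  z * matrix_coef eta x eta' x' b.
Proof. by rewrite /matrix_coef (actZl iRP) (mcRZ mc) (sr_Zl sr) (sr_hZ sr). Qed.

(* The diagonal coefficients are positive functionals on a unital C*-algebra. *)
Lemma bounded_matrix_coef_diag eta x :
  span_pi eta -> bounded_functional (matrix_coef eta x eta x).
Proof.
move=> eta_span; set g := matrix_coef _ _ _ _.
have gB b c : g (b - c) = g b - g c.
  by rewrite /g matrix_coefD -scaleN1r matrix_coefZ mulN1r.
have g_sq k : positive k -> 0 <= g (k * k).
  move=> kp; rewrite /g /matrix_coef (actM iRP) -{1}(positive_herm kp) -(act_adj iRP).
  exact: sr_ip_ge0.
have g1 : 0 <= g 1 by rewrite /g /matrix_coef (act1 iRP); exact: sr_ip_ge0.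
have herm b M : ustar b = b -> norm_le b M -> `|g b| <= g 1 * M%:C%C.
  move=> bb bM; have gM : g (M%:C%C *: 1) = g 1 * M%:C%C by rewrite /g matrix_coefZ mulrC.
  have [k [kp k2 _]] := positive_sqrt (positive_sub_norm bb bM).
  have le1 : g b <= g 1 * M%:C%C by rewrite -gM -subr_ge0 -gB -k2 g_sq.
  have [|k' [kp' k2' _]] := positive_sqrt (positive_sub_norm _ (norm_leN bM)).
    by rewrite ustarN bb.
  have le2 : - (g 1 * M%:C%C) <= g b.
    rewrite -gM -subr_ge0 opprK; have := g_sq _ kp'.
    by rewrite k2' gB -[- b]scaleN1r {2}/g matrix_coefZ mulN1r opprK addrC.
  have X0 : 0 <= g 1 * M%:C%C by rewrite mulr_ge0 // ler0c (norm_le_ge0 bM).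
  by rewrite real_ler_norml ?le1 ?le2 // (ler_real le1) ger0_real.
exists (2 * g 1); first by rewrite mulr_ge0.
(* The self-adjoint real and imaginary parts of b, each of norm at most M; hence the constant 2
   g(1). *)
move=> b M bM; pose b1 := half T *: (b + ustar b); pose b2 := half T *: (imag T *: (ustar b - b)).
have n1 : norm_le b1 M.
  have -> : M = 2^-1 * (M + M) by lra.
  by apply: norm_leZ; [rewrite invr_ge0|apply: norm_leD => //; exact: norm_le_ustar].
have n2 : norm_le b2 M.
  have -> : M = 2^-1 * (M + M) by lra.
  apply: norm_leZ; [by rewrite invr_ge0|apply: norm_leZ1; first exact: norm_ci].
  by apply: norm_leB => //; exact: norm_le_ustar.
have h1 : ustar b1 = b1.
  by rewrite /b1 ustarZ ustarD ustarK conj_cc [X in _ *: X]addrC.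
have h2 : ustar b2 = b2.
  by rewrite /b2 !ustarZ ustarB ustarK conj_cc conj_imag scaleNr -scalerN opprB.
have -> : b = b1 + imag T *: b2.
  rewrite /b1 /b2 [half T *: (imag T *: _)]scalerA [half T * _]mulrC -scalerA.
  rewrite [imag T *: (imag T *: _)]scalerA imag2 scaleN1r -scalerN opprB -scalerDr.
  by rewrite addr_add_sub scalerDr -scalerDl half2 scale1r.
rewrite {1}/g matrix_coefD matrix_coefZ (le_trans (ler_normD _ _)) //.
by rewrite normrM norm_ci mul1r -mulrA mulr_natl mulr2n lerD //; exact: herm.
Qed.

(** Polarization in the vectors, then in the module elements, reduces this to the diagonal
    coefficients. *)
Lemma bounded_matrix_coef eta x eta' x' :
  span_pi eta -> span_pi eta' -> bounded_functional (matrix_coef eta x eta' x').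
Proof.
apply: (polarization_ind (D := span_pi) (f := fun eta eta' => matrix_coef eta x eta' x')
  (c := 'i) (K := bounded_functional)).
- exact: bounded_functionalD.
- exact: bounded_functionalZ.
- exact: span_piD.
- by move=> a; exact: span_piZ.
- by move=> a a' a''; apply/funext => b; rewrite /matrix_coef (sr_D sr) (sr_hD sr).
- by move=> a a' a''; apply/funext => b; rewrite /matrix_coef (sr_hDl sr).
- by move=> a a'; apply/funext => b; rewrite /matrix_coef (sr_Z sr) (sr_hZ sr).
- by move=> a a'; apply/funext => b; rewrite /matrix_coef (sr_hZl sr) conjCi.
- exact: neq0Ci.
move=> {eta eta'} eta eta_span.
apply: (polarization_ind (D := setT) (f := fun x x' => matrix_coef eta x eta x')
  (c := 'i) (K := bounded_functional)) => //.
- exact: bounded_functionalD.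
- exact: bounded_functionalZ.
- move=> a a' a''; apply/funext => b.
  by rewrite /matrix_coef (actDr iRP) (mcRD mc) (sr_Dl sr) (sr_hD sr).
- move=> a a' a''; apply/funext => b.
  by rewrite /matrix_coef (mcRDl mc) (sr_Dl sr) (sr_hD sr).
- move=> a a'; apply/funext => b.
  by rewrite /matrix_coef (actZr iRP) (mcRZ mc) (sr_Zl sr) (sr_hZ sr).
- move=> a a'; apply/funext => b.
  by rewrite /matrix_coef (mcRZl mc) (sr_Zl sr) (sr_hZ sr) conjCi.
- exact: neq0Ci.
by move=> a _; exact: bounded_matrix_coef_diag.
Qed.

(** With l^2 = p = <v,v>_S, the vector W s p t* w is b = W s l applied to the fixed vector l t* w,
    so the value is that of a bounded coefficient at b. Moreover b b* = W s p s* W <= W P W = K^2 W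
    k^2 W, so |b| <= K delta. *)
Lemma matrix_coef_decay eta y (d : datum) (P k : UB) (K : T) :
  span_pi eta -> 0 <= K -> ustar k = k -> P = (K ^+ 2)%:C%C *: (k * k) ->
  positive (P - eS (ipS (datum_tensor d).1 (datum_tensor d).1)) ->
  exists2 C : T[i], 0 <= C & forall (W : UB) (delta : T), ustar W = W ->
    norm_le (W * k) delta ->
    `|matrix_coef eta y (datum_tensor d).2 (datum_tensor d).1 W| <= C * delta%:C%C.
Proof.
move=> eta_span K0 kk PE; case: d => [[[[[s t] v] w] r] psi] /= Pd.
have [l [lp l2 _]] := positive_sqrt (ipS_pos v); have ll := positive_herm lp.
have [C C0 hC] := bounded_matrix_coef y (act l (star t ▹ w)) eta_span (span_pi_gen r psi).
exists (C * K%:C%C); first by rewrite mulr_ge0 ?ler0c.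
move=> W delta WW Wk; pose b := W * eS s * l.
have -> : matrix_coef eta y (pi (ipR (t ▹ v) (w ◃ r)) psi) (s ▹ v) W =
    matrix_coef eta y (pi r psi) (act l (star t ▹ w)) b.
  rewrite /matrix_coef -!(sr_M sr) -!(mcRA mc); congr (h _ (pi (ipR _ _) _)).
  rewrite -!(act_ract iRP) lractA (mc_adjR mc) (mc_compat mc) lractA.
  by rewrite -!(act_emb iRP iSP mc) -!(actM iRP) -l2 /b !mulrA.
have bK : norm_le b (K * delta).
  rewrite -[b]ustarK; apply: norm_le_ustar; apply: norm_le_cstar.
    by rewrite mulr_ge0 // (norm_le_ge0 Wk).
  have -> : ustar (ustar b) * ustar b = W * eS (ipS (s ▹ v) (s ▹ v)) * W.
    rewrite ustarK /b !ustarM ll WW (mcSA mc) (mcSAr mc) !(emb_mul iSP) (emb_ustar iSP).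
    by rewrite -l2 !mulrA.
  have cpos u : positive u -> positive (W * u * W).
    by move=> /(positive_conj W); rewrite WW.
  apply: positive_norm_le; first by rewrite mulr_ge0 // (norm_le_ge0 Wk).
    exact: cpos (ipS_pos _).
  have Wkk : norm_le ((K ^+ 2)%:C%C *: (W * (k * k) * W)) ((K * delta) ^+ 2).
    rewrite exprMn; apply: norm_leZ; first by rewrite exprn_ge0.
    rewrite expr2 (_ : W * _ * W = W * k * ustar (W * k)).
      by apply: norm_leM => //; exact: norm_le_ustar.
    by rewrite ustarM kk WW !mulrA.
  have h1 := positive_sub_norm _ Wkk; have := positiveD (h1 _) (cpos _ Pd).
  rewrite {1}PE mulrBr mulrBl -scalerAr -scalerAl addrA subrK; apply.
  by rewrite ustarZ !ustarM kk WW conj_cc !mulrA.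
by rewrite -mulrA -ccM; exact: hC.
Qed.

(** By compatibility <u x_k, Theta_{y,y} u x_l> = <u x_k, y><y, u x_l>, so the double sum is the
    inner square of eta. *)
Lemma matrix_coef_conj_ge0 n (x : 'I_n -> X) (zeta : 'I_n -> H) (u : UB) y :
  0 <= \sum_k \sum_l matrix_coef (zeta k) (x k) (zeta l) (x l)
         (ustar u * eS (ipS y y) * u).
Proof.
pose eta := \sum_k pi (ipR y (act u (x k))) (zeta k).
suff -> : \sum_k \sum_l matrix_coef (zeta k) (x k) (zeta l) (x l)
    (ustar u * eS (ipS y y) * u) = h eta eta by exact: sr_h_ge0 sr _.
rewrite (sr_hsuml sr); apply: eq_bigr => k _; rewrite (sr_hsum sr); apply: eq_bigr => l _.
rewrite /matrix_coef !(actM iRP) (act_emb iRP).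
rewrite -(act_adj iRP iSP mc) -(mc_compat mc) (mcRA mc) (sr_M sr) (sr_adj sr).
by rewrite (mcRC mc).
Qed.

(* With P the sum of the ipS x_k x_k, scaled to k^2 <= 1, and w = g^2 = 1 - k^2,
   one has 1 = sum_{i < m} g^i k^2 g^i + w^m.  The first term contributes a sum of
   squares to the form, by the compatibility of the inner products; the second
   one tends to 0 since x_l = s p t* (w r) with s p s* <= P. *)
Theorem list_form_ge0 (s : seq (X * H)) : 0 <= list_form h pi ipR s s.
Proof.
have [t ht] := tensor_rel_datum s.
rewrite (list_form_relr sr (mc_ipR mc) _ ht) (list_form_rell sr (mc_ipR mc) _ ht).
pose d (k : 'I_(size t)) := tnth (in_tuple t) k.
pose x k := (datum_tensor (d k)).1; pose zeta k := (datum_tensor (d k)).2.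
pose L b := \sum_k \sum_l matrix_coef (zeta k) (x k) (zeta l) (x l) b.
have -> : list_form h pi ipR (map datum_tensor t) (map datum_tensor t) = L 1.
  rewrite /list_form big_map big_tnth; apply: eq_bigr => k _.
  by rewrite big_map big_tnth; apply: eq_bigr => l _; rewrite /matrix_coef (act1 iRP).
have LD b c : L (b + c) = L b + L c.
  rewrite -big_split; apply: eq_bigr => k _; rewrite -big_split; apply: eq_bigr => l _.
  exact: matrix_coefD.
have LZ (z : T[i]) b : L (z *: b) = z * L b.
  rewrite mulr_sumr; apply: eq_bigr => k _; rewrite mulr_sumr; apply: eq_bigr => l _.
  exact: matrix_coefZ.
have Lsum I (r : seq I) F : L (\sum_(k <- r) F k) = \sum_(k <- r) L (F k).
  elim/big_rec2: _ => [|k y z _ <-]; last exact: LD.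
  by rewrite -(scale0r 0) LZ mul0r.
pose P : UB := \sum_k eS (ipS (x k) (x k)).
have Pp : positive P by apply: positive_sum => k; exact: ipS_pos.
have [k0 [k0p k02 _]] := positive_sqrt Pp; have [K K0 k0K] := norm_le_ex_gt0 k0.
have Ki : 0 <= K^-1 by rewrite invr_ge0 ltW.
pose k := K^-1%:C%C *: k0.
have kk : ustar k = k by rewrite ustarZ conj_cc (positive_herm k0p).
have k1 : norm_le k 1 by have := norm_leZ Ki k0K; rewrite mulVf ?gt_eqF.
have PE : P = (K ^+ 2)%:C%C *: (k * k).
  rewrite -k02 -scalerAl -scalerAr !scalerA -!ccM expr2.
  by rewrite mulfK ?gt_eqF // divff ?gt_eqF // scale1r.
have [g [gg g2 gk hg]] := approximate_unit kk k1.
have zeta_span l : span_pi (zeta l).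
  by rewrite /zeta; case: (d l) => [[[[[? ?] ?] ?] ?] ?]; exact: span_pi_gen.
have dom l : positive (P - eS (ipS (x l) (x l))).
  rewrite /P (bigD1 l) // addrAC subrr add0r; elim/big_ind: _ => //.
  - exact: positive0.
  - exact: positiveD.
  - by move=> j _; exact: ipS_pos.
have coef (kl : 'I_(size t) * 'I_(size t)) : exists C : T[i], 0 <= C /\
    forall (W : UB) (delta : T), ustar W = W -> norm_le (W * k) delta ->
    `|matrix_coef (zeta kl.1) (x kl.1) (zeta kl.2) (x kl.2) W| <= C * delta%:C%C.
  have [C C0 hC] := matrix_coef_decay (x kl.1) (zeta_span kl.1) (ltW K0) kk PE (dom kl.2).
  by exists C.
have [C hC] := choice coef; pose Ctot := \sum_k \sum_l C (k, l).
have [c cE c0] : exists2 c : T, Ctot = c%:C%C & 0 <= c.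
  have : 0 <= Ctot by apply: sumr_ge0 => a _; apply: sumr_ge0 => b _; have [] := hC (a, b).
  by case: (Ctot) => a b; rewrite lecE /= => /andP[/eqP -> ?]; exists a.
(* c is the sum of all decay constants; adding 1 keeps the divisor positive when c = 0. *)
have c1 : 0 < c + 1 by rewrite ltr_wpDl.
apply: ge0_of_approx => e e0; have [m hm] := hg _ (divr_gt0 e0 c1).
have WW : ustar ((g * g) ^+ m) = (g * g) ^+ m by rewrite ustarX ustarM gg.
exists (L (1 - (g * g) ^+ m)), (L ((g * g) ^+ m)); split.
- by rewrite -LD subrK.
- have gkk : g * (k * k) = k * k * g by rewrite mulrA gk -mulrA gk mulrA.
  have kE : k * k = 1 - g * g by rewrite g2 opprB addrC subrK.
  rewrite -(sum_conj_geometric m gkk kE) Lsum; apply: sumr_ge0 => a _.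
  have -> : k * k = (K ^- 2)%:C%C *: P.
    by rewrite PE scalerA -ccM mulVf ?scale1r // expf_neq0 // gt_eqF.
  rewrite -scalerAr -scalerAl LZ mulr_ge0 //; first by rewrite ler0c invr_ge0 exprn_ge0 // ltW.
  rewrite /P mulr_sumr mulr_suml Lsum; apply: sumr_ge0 => j _.
  have := matrix_coef_conj_ge0 x zeta (g ^+ a) (x j).
  by rewrite ustarX gg.
rewrite (le_trans (ler_norm_sum _ _ _)) //.
have : Ctot * (e / (c + 1))%:C%C <= e%:C%C.
  by rewrite cE -ccM lecR mulrCA ger_pMr // ler_pdivrMr // mul1r lerDl.
apply: le_trans; rewrite mulr_suml; apply: ler_sum => a _.
rewrite (le_trans (ler_norm_sum _ _ _)) // mulr_suml; apply: ler_sum => b _.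
by have [_] := hC (a, b); exact.
Qed.

End Positivity.

(** * Equivalence bimodules *)

Section PropertyP.
Variables (T : realType) (A B : cstarAlgType T) (R S : starAlgType T[i]).
Variables (iR : R -> A) (iS : S -> B).
Hypotheses (iRP : ideal_embedding iR) (iSP : ideal_embedding iS).
Variables (X : bimodType S R) (ipR : X -> X -> R) (ipS : X -> X -> S).
Hypothesis mc : Morita_context ipR ipS.
Hypothesis ipR_pos : forall x, emb_positive iR (ipR x x).
Hypothesis ipS_pos : forall x, emb_positive iS (ipS x x).

Lemma property_P_of_positive : property_P ipR.
Proof.
move=> H pi piP u; apply: (list_form_ge0 iRP iSP mc ipR_pos ipS_pos).
have piL r := srep_linear piP r.
split=> [a b c|z a b|a b c|z a b|a|r a b|r z a|r s a|z r a|r s a|r a b].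
- exact: hdotD.
- exact: hdotZ.
- by rewrite hdotC hdotD rmorphD [hdot a c]hdotC [hdot b c]hdotC.
- by rewrite hdotC hdotZ rmorphM [hdot a b]hdotC.
- have [->|a0] := eqVneq a 0; last exact/ltW/hdot_gt0.
  by have := hdotZ 0 (0 : H) 0; rewrite scale0r mul0r => ->.
- by have := piL r 1 a b; rewrite !scale1r.
- have pi0 : pi r 0 = 0 by have := piL r (-1) 0 0; rewrite scaler0 addr0 scaleN1r addNr.
  by have := piL r z a 0; rewrite pi0 !addr0.
- exact: srepD piP _ _ _.
- exact: srepZ piP _ _ _.
- exact: srepM piP _ _ _.
- exact: srep_adjoint piP _ _ _.
Qed.

Lemma span_ract x : exists s : seq (X * R), x = \sum_(p <- s) p.1 ◃ p.2.
Proof.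
apply: (lspan_ind (K := fun x => exists s : seq (X * R), x = \sum_(p <- s) p.1 ◃ p.2)
  (mc_spanR mc)) x.
- by exists [::]; rewrite big_nil.
- by move=> x y [s ->] [t ->]; exists (s ++ t); rewrite big_cat.
- by move=> c _ [x [r ->]]; exists [:: (x, c *: r)]; rewrite big_seq1 ractZr.
Qed.

(** The functional w lives on R only, so positivity in A does not settle the matter. Let R act on
    itself by left multiplication, with the form w(a* b); writing x as a sum of x_i r_i exhibits
    w(<x,x>) as a value of [list_form]. *)
Lemma ip_positive_of_positive : ip_positive ipR.
Proof.
move=> x; split=> [|w wP]; first exact: mcRC mc _ _.
have [s xE] := span_ract x.
pose h (a b : R) : T[i] := w (star a ⋅ b).
have sr : semi_representation h (fun r a => r ⋅ a).
  split=> [a b c|z a b|a b c|z a b|a|r a b|r z a|r t a|z r a|r t a|r a b]; rewrite /h.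
  - by rewrite amulDr linearD.
  - by rewrite amulZr linearZ.
  - by rewrite starD amulDl linearD.
  - by rewrite starZ amulZl linearZ.
  - exact: wP.
  - exact: amulDr.
  - exact: amulZr.
  - exact: amulDl.
  - exact: amulZl.
  - by rewrite amulA.
  - by rewrite starM amulA.
have := list_form_ge0 iRP iSP mc ipR_pos ipS_pos sr s.
suff -> : list_form h (fun r a => r ⋅ a) ipR s s = w (ipR x x) by [].
have ip_sumr y (t : seq (X * R)) :
    ipR y (\sum_(p <- t) p.1 ◃ p.2) = \sum_(p <- t) ipR y p.1 ⋅ p.2.
  by elim/big_rec2: _ => [|p b a _ <-]; rewrite ?(mcR0 mc) // (mcRD mc) (mcRA mc).
rewrite {2}xE ip_sumr xE linear_sum /list_form exchange_big; apply: eq_bigr => q _ /=.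
rewrite -(mcRC mc) ip_sumr star_sum amul_suml linear_sum; apply: eq_bigr => p _.
by rewrite /h starM (mcRC mc) amulA.
Qed.

End PropertyP.

Lemma equivalence_of_context (T : realType) (A B : cstarAlgType T)
    (R S : starAlgType T[i]) (iR : R -> A) (iS : S -> B) (X : bimodType S R)
    (ipR : X -> X -> R) (ipS : X -> X -> S) :
  ideal_embedding iR -> ideal_embedding iS -> Morita_context ipR ipS ->
  formally_Morita_equivalent R S.
Proof.
move=> iRP iSP /(Morita_context_positive iRP iSP)[ipR' [ipS' [mc pR pS]]].
have mcC := Morita_context_conj mc.
exists X, ipR', ipS'; split.
- exact: mc_ipR mc.
- exact: (ip_positive_of_positive iRP iSP mc).
- exact: mc_fullR mc.
- exact: mc_ipS mc.
- exact: (ip_positive_of_positive iSP iRP mcC).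
- exact: mc_fullS mc.
- exact: mc_adjR mc.
- exact: mc_adjS mc.
- exact: mc_compat mc.
- exact: (property_P_of_positive iRP iSP mc).
- exact: (property_P_of_positive iSP iRP mcC).
Qed.

(** * The Morita context of a Morita *-equivalence *)

Section FiniteRankModule.
Variables (C : numClosedFieldType) (R S : starAlgType C) (E : rightModType R).
Variables (ip : E -> E -> R) (ipP : right_inner_product ip).
Variables (phi : S -> E -> E) (phiP : star_iso_finite_rank ip phi).
Implicit Types (x y z : E) (s t : S) (c : C).

Lemma finite_rank_sum (f : E -> E) : finite_rank ip f ->
  exists s : seq (C * (E * E)), f = \sum_(p <- s) p.1 *: Theta ip p.2.1 p.2.2.
Proof.
move=> [s sT ->]; elim: s sT => [|[c f'] s ih] sT.
  by exists [::]; rewrite !big_nil.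
have [q qs|t e] := ih; first by apply: sT; rewrite inE qs orbT.
have [x [y ->]] : exists x y, f' = Theta ip x y := sT (c, f') (mem_head _ _).
by exists ((c, (x, y)) :: t); rewrite !big_cons e.
Qed.

Lemma sum_ThetaE (s : seq (C * (E * E))) z :
  (\sum_(p <- s) p.1 *: Theta ip p.2.1 p.2.2) z =
  \sum_(p <- s) p.1 *: (p.2.1 ◃ ip p.2.2 z).
Proof. by rewrite fct_sumE. Qed.

Lemma phi_sum s : exists t : seq (C * (E * E)),
  phi s = \sum_(p <- t) p.1 *: Theta ip p.2.1 p.2.2.
Proof. by apply: finite_rank_sum; rewrite -(sif_onto phiP); exists s. Qed.

Lemma phi_add s x y : phi s (x + y) = phi s x + phi s y.
Proof.
have [t ->] := phi_sum s; rewrite !sum_ThetaE -big_split; apply: eq_bigr => p _.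
by rewrite (ripD ipP) ractDr scalerDr.
Qed.
Lemma phi_scale c s x : phi s (c *: x) = c *: phi s x.
Proof.
have [t ->] := phi_sum s; rewrite !sum_ThetaE scaler_sumr; apply: eq_bigr => p _.
by rewrite (ripZ ipP) ractZr !scalerA mulrC.
Qed.
Lemma phi_ract s x r : phi s x ◃ r = phi s (x ◃ r).
Proof.
have [t ->] := phi_sum s; rewrite !sum_ThetaE.
elim/big_rec2: _ => [|p b a _ <-]; first by rewrite -(scale0r 0) ractZl !scale0r.
by rewrite ractDl ractZl ractA (ripA ipP).
Qed.

(** The phantom arguments let the type remember [phi] and its properties, on which the left action
    of S depends. *)
Definition finite_rank_module (_ : right_inner_product ip)
  (_ : star_iso_finite_rank ip phi) : Type := E.
Local Notation M := (finite_rank_module ipP phiP).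

HB.instance Definition _ := RightModule.copy M E.

Definition frm_lact (s : S) (x : M) : M := phi s x.

Lemma frm_lactDl s t (x : M) : frm_lact (s + t) x = frm_lact s x + frm_lact t x.
Proof. by rewrite /frm_lact (sifD phiP). Qed.
Lemma frm_lactDr s (x y : M) : frm_lact s (x + y) = frm_lact s x + frm_lact s y.
Proof. exact: phi_add. Qed.
Lemma frm_lactZl c s (x : M) : frm_lact (c *: s) x = c *: frm_lact s x.
Proof. by rewrite /frm_lact (sifZ phiP). Qed.
Lemma frm_lactZr c s (x : M) : frm_lact s (c *: x) = c *: frm_lact s x.
Proof. exact: phi_scale. Qed.
Lemma frm_lactA s t (x : M) : frm_lact s (frm_lact t x) = frm_lact (s ⋅ t) x.
Proof. by rewrite /frm_lact (sifM phiP). Qed.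
HB.instance Definition _ := Lmodule_isLeftModule.Build C S M
  frm_lactDl frm_lactDr frm_lactZl frm_lactZr frm_lactA.

Lemma frm_lractA s (x : M) (r : R) : (s ▹ x) ◃ r = s ▹ (x ◃ r).
Proof. exact: phi_ract. Qed.
HB.instance Definition _ := isBimodule.Build C S R M frm_lractA.

Lemma Theta_ex x y : exists s, phi s = Theta ip x y.
Proof.
have : finite_rank ip (Theta ip x y).
  by rewrite -(scale1r (Theta ip x y)); apply: lspanZ; exists x, y.
by rewrite -(sif_onto phiP) => -[s _ <-]; exists s.
Qed.

Definition frm_ipS (x y : M) : S := projT1 (cid (Theta_ex x y)).
Lemma frm_ipSE (x y z : M) : frm_ipS x y ▹ z = x ◃ ip y z.
Proof. by rewrite /lact /= /frm_lact /frm_ipS (projT2 (cid (Theta_ex x y))). Qed.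
Lemma frm_ipS_phi (x y : M) : phi (frm_ipS x y) = Theta ip x y.
Proof. exact: projT2 (cid (Theta_ex x y)). Qed.

Lemma frm_sep s t : (forall x : M, s ▹ x = t ▹ x) -> s = t.
Proof. by move=> h; apply: (sif_inj phiP); apply/funext. Qed.

Lemma frm_adjR s (x y : M) : ip (s ▹ x) y = ip x (star s ▹ y).
Proof.
have [t tE] := phi_sum s; have := sif_star phiP tE.
change (phi (star s) = \sum_(p <- t) p.1^* *: Theta ip p.2.2 p.2.1 ->
  ip (phi s x) y = ip x (phi (star s) y)); rewrite tE => ->.
rewrite (ripC ipP) !fct_sumE.
elim/big_rec2: _ => [|p b a _ e].
  by rewrite -(scale0r (0 : E)) !(ripZ ipP) !scale0r star_0.
rewrite !(ripD ipP) starD e; congr (_ + _).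
by rewrite !(ripZ ipP) !(ripA ipP) starZ starM -(ripC ipP) -(ripC ipP).
Qed.

End FiniteRankModule.

(** As [phi] is injective, identities in S are checked on E. Fullness and x <y,z> = <x,y>_S z turn
    nondegeneracy and spanning over R into the same over S. *)
Lemma Morita_star_context (C : numClosedFieldType) (R S : starAlgType C)
    (E : rightModType R) (ip : E -> E -> R) (ipP : right_inner_product ip)
    (phi : S -> E -> E) (phiP : star_iso_finite_rank ip phi) :
  Morita_star_module S ip ->
  @Morita_context C S R (finite_rank_module ipP phiP) ip
    (@frm_ipS C R S E ip ipP phi phiP).
Proof.
move=> ms; set X := finite_rank_module ipP phiP; set ipS := @frm_ipS _ _ _ _ _ _ _ _.
have ipSE (x y z : X) : ipS x y ▹ z = x ◃ ip y z by exact: frm_ipSE.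
have sep s t : (forall x : X, s ▹ x = t ▹ x) -> s = t by exact: frm_sep.
have ipSZ c (x y : X) : ipS (c *: x) y = c *: ipS x y.
  by apply: sep => w; rewrite lactZl !ipSE ractZl.
have ract_ind (K : X -> Prop) (x : X) : K 0 -> (forall y z, K y -> K z -> K (y + z)) ->
    (forall (c : C) y, K y -> K (c *: y)) -> (forall y z, K (x ◃ ip y z)) -> forall r, K (x ◃ r).
  move=> K0 KD KZ Kip; apply: (lspan_ind (K := fun r => K (x ◃ r)) (msm_full ms)).
  - by rewrite ract0r.
  - by move=> r r' ? ?; rewrite ractDr; exact: KD.
  - by move=> c _ [y [z ->]]; rewrite ractZr; exact: KZ.
split.
- split; [exact: (ripD ipP)|exact: (ripZ ipP)|exact: (ripA ipP)|exact: (ripC ipP)].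
- split=> [x y z|//|s x y|x y].
  + by apply: sep => w; rewrite lactDl !ipSE ractDl.
  + by apply: sep => w; rewrite -lactA !ipSE lractA.
  + apply: (sif_inj phiP); rewrite /ipS frm_ipS_phi.
    have := sif_star phiP (a := ipS y x) (s := [:: (1, (y, x))]).
    by rewrite !big_seq1 /= rmorph1 !scale1r /ipS frm_ipS_phi; symmetry; auto.
- exact: msm_full ms.
- apply/seteqP; split=> // s _; have [t tE] := phi_sum phiP s.
  have -> : s = \sum_(p <- t) p.1 *: ipS p.2.1 p.2.2.
    apply: sep => x; change (phi s x = (\sum_(p <- t) p.1 *: ipS p.2.1 p.2.2) ▹ (x : X)).
    rewrite tE fct_sumE; elim/big_rec2: _ => [|p b a _ e]; first by rewrite lact0l.
    by rewrite lactDl lactZl ipSE -e.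
  elim: t {tE} => [|p t ih]; first by rewrite big_nil; exact: lspan0.
  by rewrite big_cons; apply: lspanD => //; apply: lspanZ; exists p.2.1, p.2.2.
- by move=> s x y; exact: frm_adjR.
- move=> r x y; apply: sep => w; rewrite !ipSE ractA.
  congr (_ ◃ _); rewrite (ripC ipP) [RHS](ripC ipP) (ripA ipP) starM starK.
  by rewrite -(ripC ipP).
- by move=> x y z; rewrite ipSE.
- exact: msm_ip_nondeg ms.
- move=> x h; apply: (msm_nondeg ms) => r.
  apply: (ract_ind (fun y => y = 0) x) => //.
  - by move=> y z -> ->; rewrite addr0.
  - by move=> c y ->; rewrite scaler0.
  - by move=> y z; rewrite -ipSE h lact0l.
- exact: msm_idem ms.
apply/seteqP; split=> // x _.
apply: (lspan_ind (msm_idem ms)) x.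
- exact: lspan0.
- by move=> x y; exact: lspanD.
move=> c _ [{}x [r ->]]; rewrite -ractZr.
apply: (ract_ind (lspan _)).
- exact: lspan0.
- by move=> y z; exact: lspanD.
- by move=> a y; exact: lspan_scale.
by move=> y z; rewrite -ipSE -[X in lspan _ X]scale1r; apply: lspanZ; exists (ipS x y), z.
Qed.

(** * Application to Pedersen ideals *)

Lemma Pedersen_embedding (T : realType) (A : cstarAlgType T) (P : set A)
  (hP : Pedersen_ideal P) : ideal_embedding (@Pedersen_val T A P hP).
Proof.
split=> [|//|//|//|//|a r]; first exact: val_inj.
have Pr : a ⋅ Pedersen_val r \in Pedersen_pred hP.
  by have [idP _ _] := hP; case: r => r /=; rewrite !inE; exact: (idealMl idP).
by exists (PedersenAlg Pr).
Qed.

Theorem corollary3p6 (R : realType) (A B : cstarAlgType R)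
  (PA : set A) (hPA : Pedersen_ideal PA)
  (PB : set B) (hPB : Pedersen_ideal PB) :
  Morita_star_equivalent (Pedersen_alg hPA) (Pedersen_alg hPB) ->
  formally_Morita_equivalent (Pedersen_alg hPA) (Pedersen_alg hPB).
Proof.
move=> [_ _ [E [ip ms]]]; have [phi phiP] := msm_iso ms.
exact: equivalence_of_context (Pedersen_embedding hPA) (Pedersen_embedding hPB)
  (Morita_star_context (msm_ip ms) phiP ms).
Qed.
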